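(* Let $p\ge3$ and fix $\beta>\beta^*(p)$. The set of all null parameters $\beta_0>\beta^*(p)$ (with $\beta_0<\beta$) satisfying $\mathrm{eff}(\hat{\beta}_{\mathrm{ML}},\hat{\beta}_{\mathrm{MPL}};\beta_0,\beta)>1$ is $$\left(\beta^*(p),\ \frac{I(m_*(\beta,p))}{m_*(\beta,p)^p}\right),\qquad I(x)=\tfrac12\{(1+x)\log(1+x)+(1-x)\log(1-x)\}.$$ Further, for every $p\ge3$, every fixed $\beta>\beta^*(p)$ and every $\delta\in(0,1)$, $$\lim_{\beta_0\to\beta^*(p)^+}N_{\hat{\beta}_{\mathrm{MPL}}}^*(\beta_0,\beta,\delta,p)=\infty\quad\text{and}\quad\lim_{\beta_0\to\beta^*(p)^+}N_{\hat{\beta}_{\mathrm{ML}}}^*(\beta_0,\beta,\delta,p)=\frac{\log(\delta)}{H_{\beta^*(p),p}(m_*(\beta,p))}<\infty,$$ and hence $$\lim_{\beta_0\to\beta^*(p)^+}\mathrm{eff}(\hat{\beta}_{\mathrm{ML}},\hat{\beta}_{\mathrm{MPL}};\beta_0,\beta)=\infty.$$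
   Context: **Model.** For an integer $p\ge2$ and $n\ge 1$, the $p$-tensor Curie-Weiss model with parameter $\beta$ is the probability mass function on $\{-1,1\}^n$ $$\mathbb{P}_{\beta,p}(x)=\frac{\exp\{\beta n^{1-p}\sum_{1\le i_1,\dots,i_p\le n}x_{i_1}\cdots x_{i_p}\}}{2^nZ_n(\beta,p)},$$ with $Z_n(\beta,p)$ the normalizing constant. $X=(X_1,\dots,X_n)$ denotes a sample from it and $\overline{X}_n=\frac1n\sum_{i=1}^nX_i$. **Functions and threshold.** For $x\in[-1,1]$ (with $0\log0=0$), $H_{\beta,p}(x)=\beta x^p-\tfrac12\{(1+x)\log(1+x)+(1-x)\log(1-x)\}$, and $\beta^*(p)=\sup\{\beta\ge0:\sup_{x\in[-1,1]}H_{\beta,p}(x)=0\}$. For $\beta>\beta^*(p)$, $m_*(\beta,p)\in(0,1)$ denotes the unique positive global maximizer of $H_{\beta,p}$. **Estimators.** $\hat{\beta}_{\mathrm{ML}}$ is the maximum likelihood estimator of $\beta$, i.e. the maximizer of $\beta\mapsto\mathbb{P}_{\beta,p}(X)$ (equal to $\pm\infty$ if the supremum is only approached at $\pm\infty$). The maximum pseudolikelihood estimator is given explicitly by $\hat{\beta}_{\mathrm{MPL}}=p^{-1}\overline{X}_n^{1-p}\tanh^{-1}(\overline{X}_n)$ if $\overline{X}_n\ne0$ and $0$ if $\overline{X}_n=0$ (extended-real valued when $\overline X_n=\pm1$). **Bahadur slope.** Consider testing $H_0:\beta=\beta_0$ versus $H_1:\beta>\beta_0$ with $\beta_0>\beta^*(p)$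 using $T_n=\sqrt n(\hat\beta-\beta_0)$, where $\hat\beta$ is $\hat{\beta}_{\mathrm{ML}}$ or $\hat{\beta}_{\mathrm{MPL}}$, large values being significant. Let $F_{T_n,\beta_0}$ be the cumulative distribution function of $T_n$ under $\mathbb{P}_{\beta_0,p}$ and $L_n=1-F_{T_n,\beta_0}(T_n)$. The (weak) Bahadur slope of $\hat\beta$ at the alternative $\beta$ is the constant $c_{\hat\beta}(\beta_0,\beta,p)$ such that $\frac1n\log L_n\to-\frac12c_{\hat\beta}(\beta_0,\beta,p)$ in probability as $n\to\infty$ when $X\sim\mathbb{P}_{\beta,p}$. The asymptotic optimal sample size is $N^*_{\hat\beta}(\beta_0,\beta,\delta,p)=-2\log(\delta)/c_{\hat\beta}(\beta_0,\beta,p)$, and $\mathrm{eff}(\hat\beta_1,\hat\beta_2;\beta_0,\beta)=c_{\hat\beta_1}(\beta_0,\beta,p)/c_{\hat\beta_2}(\beta_0,\beta,p)$. *)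

(* Defs.v *)
(* MathComp / MathComp-Analysis. *)
From HB Require Import structures.
From mathcomp Require Import all_boot all_order all_algebra.
From mathcomp Require Import all_classical all_reals all_analysis.

Set Implicit Arguments.
Unset Strict Implicit.
Unset Printing Implicit Defensive.

Import Order.TTheory GRing.Theory Num.Theory.
Import numFieldNormedType.Exports.

Local Open Scope classical_set_scope.
Local Open Scope ring_scope.

(* A configuration in {-1,1}^n; [true] encodes the spin +1. *)
Definition config (n : nat) := {ffun 'I_n -> bool}.

Section CurieWeiss.
Variable R : realType.
Implicit Types (n p : nat) (beta x : R).

Definition spin n (X : config n) (i : 'I_n) : R := if X i then 1 else -1.

Definition mean n (X : config n) : R := n%:R^-1 * \sum_(i < n) spin X i.

(* The unnormalized weight; the tuple (i_1, ..., i_p) is a function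
   'I_p -> 'I_n. *)
Definition weight n p beta (X : config n) : R :=
  expR (beta * n%:R ^ (1 - p%:Z) *
        \sum_(i : {ffun 'I_p -> 'I_n}) \prod_(j < p) spin X (i j)).

Definition partition_function n p beta : R :=
  (2 ^+ n)^-1 * \sum_(X : config n) weight p beta X.

Definition pmf n p beta (X : config n) : R :=
  weight p beta X / (2 ^+ n * partition_function n p beta).

Definition prob n p beta (A : pred (config n)) : R :=
  \sum_(X : config n | A X) pmf p beta X.

(* [ln 0 = 0], so 0 log 0 = 0 at the endpoints. *)
Definition entropyI x : R :=
  2^-1 * ((1 + x) * ln (1 + x) + (1 - x) * ln (1 - x)).

Definition H beta p x : R := beta * x ^+ p - entropyI x.

Definition betastar p : R :=
  sup [set beta | 0 <= beta /\ sup (H beta p @` `[-1, 1]) = 0].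

Definition mstar beta p : R :=
  xget 0 [set m | 0 < m < 1 /\
                  forall x, x \in `[-1, 1]%R -> H beta p x <= H beta p m].

Definition statistic := forall n, config n -> \bar R.

(* The likelihood is maximized over all real parameters; the value is
   infinite when there is no maximizer and the supremum is the limit at the
   corresponding infinity. *)
Definition is_mle p n (X : config n) (b : \bar R) : Prop :=
  let lik (r : R) := pmf p r X in
  let no_max := forall r, exists r', lik r < lik r' in
  match b with
  | r%:E => forall r', lik r' <= lik r
  | +oo%E => no_max /\ lik r @[r --> +oo] --> sup (range lik)
  | -oo%E => no_max /\ lik r @[r --> -oo] --> sup (range lik)
  end.

(* For n = 1 and p even the likelihood is constant, and [xget] picks some
   maximizer. *)
Definition mle p : statistic := fun n X => xget 0%E (is_mle p X).

(* With [lne 0 = -oo] this is +oo at 1 and -oo at -1. *)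
Definition artanh x : \bar R :=
  ((2^-1)%:E * (lne (1 + x)%:E - lne (1 - x)%:E))%E.

Definition mple p : statistic := fun n X =>
  let m := mean X in
  if m == 0 then 0%E else ((p%:R^-1 * m ^ (1 - p%:Z))%:E * artanh m)%E.

Definition test_stat (est : statistic) beta0 n (X : config n) : \bar R :=
  ((Num.sqrt n%:R)%:E * (est n X - beta0%:E))%E.

Definition test_stat_cdf (est : statistic) p beta0 n (t : \bar R) : R :=
  prob p beta0 (fun X : config n => (test_stat est beta0 X <= t)%E).

Definition p_value (est : statistic) p beta0 n (X : config n) : R :=
  1 - test_stat_cdf est p beta0 n (test_stat est beta0 X).

(* Convergence in probability to the constant a, under the law with
   parameter beta, of a sequence of extended real statistics. *)
Definition cvg_in_prob p beta (Y : statistic) (a : R) : Prop :=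
  forall eps : R, 0 < eps ->
    prob p beta (fun X : config n => (eps%:E <= `|Y n X - a%:E|)%E)
      @[n --> \oo] --> (0 : R).

Definition is_bahadur_slope (est : statistic) p beta0 beta (c : R) : Prop :=
  cvg_in_prob p beta
    (fun n X => ((n%:R^-1)%:E * lne (p_value est p beta0 X)%:E)%E)
    (- (2^-1 * c)).

Definition bahadur_slope (est : statistic) p beta0 beta : R :=
  xget 0 (is_bahadur_slope est p beta0 beta).

Definition opt_sample_size (est : statistic) p beta0 beta (delta : R) : R :=
  - 2 * ln delta / bahadur_slope est p beta0 beta.

Definition eff (est1 est2 : statistic) p beta0 beta : R :=
  bahadur_slope est1 p beta0 beta / bahadur_slope est2 p beta0 beta.

End CurieWeiss.

(* Main.v *)
Require Import Defs.
From mathcomp Require Import all_boot all_order all_algebra.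
From mathcomp Require Import all_classical all_reals all_analysis.
From mathcomp Require Import ring lra.
Import Order.TTheory GRing.Theory Num.Theory.
Import numFieldNormedType.Exports.
Set Implicit Arguments.
Unset Strict Implicit.
Unset Printing Implicit Defensive.
Local Open Scope classical_set_scope.
Local Open Scope ring_scope.

(** The weight of a configuration depends only on its mean m, and the number of
    configurations of mean m is 2^n exp(- n I(m)) up to a factor n + 1. Hence
    the mean satisfies a large deviation principle under the law of parameter b
    with rate max H_b - H_b, and |mean| concentrates at m_*(b).

    The p-value of an estimator is the null probability of a strictly larger
    estimate. The likelihood is that of an exponential family with sufficient
    statistic mean^p, so the ML estimate is a strictly increasing function of
    mean^p and the p-value is the null probability of |mean| > m_*(b), roughly:
    the exponent is H_b0(m_*(b)) - max H_b0. The MPL estimate is the function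
    stat_beta of the mean whose level b consists of the stationary points of
    H_b. This function decreases and then increases on (0, 1), so its upper
    level set contains in addition a neighbourhood of 0, where H_b0 is close to
    0: the exponent is max(0, H_b0(m_*(b))) - max H_b0. The two slopes thus
    differ exactly when H_b0(m_*(b)) < 0, and max H_b0 tends to 0 as b0
    decreases to the threshold. *)

(** * Binomial coefficients and the entropy *)

Section Counting.
Variable R : realType.
Implicit Types (n p : nat) (b x y : R).

(** The sum over index tuples factors as the [p]-th power of the total spin. *)
Lemma weightE n p b (X : config n) : (0 < n)%N ->
  weight p b X = expR (n%:R * (b * mean R X ^+ p)).
Proof.
move=> n0; rewrite /weight /mean; congr expR.
have nz : n%:R != 0 :> R by rewrite pnatr_eq0 -lt0n.
have -> : \sum_(i : {ffun 'I_p -> 'I_n}) \prod_(j < p) spin R X (i j) =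
    (\sum_(i < n) spin R X i) ^+ p.
  rewrite -[in RHS](card_ord p) -prodr_const.
  by rewrite (bigA_distr_bigA (fun _ => spin R X)).
rewrite exprMn expfzDr// expr1z -exprnN exprVn; ring.
Qed.

Definition ups n (X : config n) := #|[pred i | X i]|.

(** The mean of a configuration with [k] spins +1 out of [n]. *)
Definition level n k : R := 2 * k%:R / n%:R - 1.

Lemma ups_le n (X : config n) : (ups X <= n)%N.
Proof. by rewrite -[leqRHS]card_ord max_card. Qed.

Lemma mean_ups n (X : config n) : (0 < n)%N -> mean R X = level n (ups X).
Proof.
move=> n0; have nz : n%:R != 0 :> R by rewrite pnatr_eq0 -lt0n.
have -> : mean R X = n%:R^-1 * \sum_(i < n) (2 * (X i)%:R - 1).
  by rewrite /mean; congr (_ * _); apply: eq_bigr => i _; rewrite /spin; case: (X i) => /=; ring.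
rewrite big_split/= sumrN sumr_const card_ord -mulr_sumr -natr_sum.
rewrite (_ : (\sum_(i < n) X i = ups X)%N); last first.
  by rewrite /ups -sum1_card [RHS]big_mkcond; apply: eq_bigr => i _; rewrite inE; case: (X i).
by rewrite /level; field.
Qed.

Lemma card_ups n k : #|[pred X : config n | ups X == k]| = 'C(n, k).
Proof.
pose f (X : config n) := [set i | X i]%SET.
have f_inj : injective f.
  by move=> X Y /setP XY; apply/ffunP => i; have := XY i; rewrite !inE.
rewrite -[in RHS](card_ord n) -card_draws -(card_imset _ f_inj).
apply: eq_card => A; rewrite inE; apply/imsetP/eqP.
  by case=> X; rewrite inE => /eqP <- ->; apply: eq_card => i; rewrite !inE.
move=> Ak; exists [ffun i => i \in A]; last by apply/setP => i; rewrite inE ffunE.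
by rewrite inE -Ak; apply/eqP/eq_card => i; rewrite !inE ffunE.
Qed.


Lemma fact_le_factX k j : (j <= k)%N -> (k`! <= j`! * k ^ (k - j))%N.
Proof.
move=> jk; rewrite -(subnKC jk); move: (k - j)%N => d {k jk}; rewrite addKn.
elim: d => [|d ih]; first by rewrite addn0 muln1.
rewrite addnS factS expnS mulnCA leq_mul2l/= (leq_trans ih)// leq_mul//.
by case: d {ih} => // d; rewrite leq_exp2r.
Qed.

Lemma factX_le_fact k j : (k <= j)%N -> (k`! * k ^ (j - k) <= j`!)%N.
Proof.
move=> kj; rewrite -(subnKC kj); move: (j - k)%N => d {j kj}; rewrite addKn.
elim: d => [|d ih]; first by rewrite addn0 muln1.
by rewrite addnS factS expnS mulnCA leq_mul// leqW// leq_addr.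
Qed.

(* The binomial law with parameter k/n has its mode at k. *)
Lemma binomial_mode n k j : (k <= n)%N -> (j <= n)%N ->
  ('C(n, j) * (k ^ j * (n - k) ^ (n - j)) <=
   'C(n, k) * (k ^ k * (n - k) ^ (n - k)))%N.
Proof.
move=> kn jn.
rewrite -(@leq_pmul2r (j`! * (n - j)`! * (k`! * (n - k)`!))) ?muln_gt0 ?fact_gt0//.
have -> : ('C(n, j) * (k ^ j * (n - k) ^ (n - j)) * (j`! * (n - j)`! * (k`! * (n - k)`!))
  = n`! * ((k`! * k ^ j) * ((n - k)`! * (n - k) ^ (n - j))))%N.
  by rewrite -(bin_fact jn); ring.
have -> : ('C(n, k) * (k ^ k * (n - k) ^ (n - k)) * (j`! * (n - j)`! * (k`! * (n - k)`!))
  = n`! * ((j`! * k ^ k) * ((n - j)`! * (n - k) ^ (n - k))))%N.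
  by rewrite -(bin_fact kn); ring.
rewrite leq_mul2l; apply/orP; right.
(* The Poisson weight a^c / c! is largest at c = a; the instances (k, j) and (n - k, n - j) are
   multiplied. *)
have fact_expn a c : (a`! * a ^ c <= c`! * a ^ a)%N.
  have [ca|/ltnW ac] := leqP c a.
    have -> : (a ^ a = a ^ (a - c) * a ^ c)%N by rewrite -expnD subnK.
    by rewrite mulnA leq_mul2r fact_le_factX ?orbT.
  have -> : (a ^ c = a ^ (c - a) * a ^ a)%N by rewrite -expnD subnK.
  by rewrite mulnA leq_mul2r factX_le_fact ?orbT.
exact: leq_mul.
Qed.

(** The left side is one term of the binomial expansion of (k + (n - k))^n. *)
Lemma binomial_upper n k : (k <= n)%N ->
  ('C(n, k) * (k ^ k * (n - k) ^ (n - k)) <= n ^ n)%N.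
Proof.
move=> kn; rewrite -{4}(subnKC kn) addnC Pascal.
rewrite (bigD1 (Ordinal (kn : k < n.+1)%N))//= mulnC.
by rewrite mulnC [(k ^ k * _)%N]mulnC leq_addr.
Qed.

(** The same expansion has n + 1 terms, none larger than the one at the mode. *)
Lemma binomial_lower n k : (k <= n)%N ->
  (n ^ n <= n.+1 * ('C(n, k) * (k ^ k * (n - k) ^ (n - k))))%N.
Proof.
move=> kn; rewrite -{1}(subnKC kn) addnC Pascal.
rewrite -[in leqRHS](card_ord n.+1) -sum_nat_const leq_sum// => j _.
by rewrite [((n - k) ^ _ * _)%N]mulnC binomial_mode// -ltnS.
Qed.

Lemma mulr_ln_natX k y : 0 < y -> k%:R * ln (k%:R * y) = ln ((k ^ k)%:R : R) + k%:R * ln y.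
Proof.
move=> y0; case: k => [|k]; first by rewrite !mul0r expn0 ln1 addr0.
have k0 : 0 < k.+1%:R :> R by rewrite ltr0n.
by rewrite natrX lnXn// lnM ?posrE// mulrDr [_ * ln k.+1%:R]mulr_natl.
Qed.

Lemma entropy_level n k : (0 < n)%N -> (k <= n)%N ->
  2 ^+ n * expR (- (n%:R * entropyI (level n k))) * ((k ^ k * (n - k) ^ (n - k))%N)%:R
  = (n ^ n)%:R :> R.
Proof.
move=> n0 kn; have n0R : 0 < n%:R :> R by rewrite ltr0n.
have n2 : 0 < 2 / n%:R :> R by rewrite divr_gt0.
have knat m : 0 < ((m ^ m)%:R : R) by rewrite ltr0n; case: m => // m; rewrite expn_gt0.
have E : n%:R * entropyI (level n k) =
  k%:R * ln (k%:R * (2 / n%:R)) + (n - k)%:R * ln ((n - k)%:R * (2 / n%:R) : R).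
  rewrite /entropyI /level natrB//.
  rewrite (_ : 1 + _ = k%:R * (2 / n%:R)); last by ring.
  rewrite (_ : 1 - _ = (n%:R - k%:R) * (2 / n%:R)); last by field; exact: lt0r_neq0.
  by field; exact: lt0r_neq0.
rewrite E !mulr_ln_natX// natrB// ln_div ?posrE//.
have lnKR (z : R) : 0 < z -> z = expR (ln z) by move=> z0; rewrite lnK ?posrE.
have expX (z : R) : 0 < z -> z ^+ n = expR (n%:R * ln z).
  by move=> z0; rewrite expRM_natl -lnKR.
rewrite natrM (lnKR _ (knat k)) (lnKR _ (knat (n - k)%N)) [(n ^ n)%:R]natrX !expX// -!expRD !expRK.
by congr expR; ring.
Qed.

End Counting.

(** * Large deviation bounds for the mean at finite n *)

Section LargeDeviations.
Variable R : realType.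
Implicit Types (n p : nat) (b x y M : R).

Lemma ler_sum_subpred (I : finType) (P Q : pred I) (F : I -> R) :
  (forall i, Q i -> 0 <= F i) -> (forall i, P i -> Q i) ->
  \sum_(i | P i) F i <= \sum_(i | Q i) F i.
Proof.
move=> F0 PQ; rewrite [leLHS]big_mkcond [leRHS]big_mkcond ler_sum// => i _.
by case: ifPn => [/PQ ->//|_]; case: ifP => // /F0.
Qed.

Lemma weight_gt0 n p b (X : config n) : 0 < weight p b X.
Proof. exact: expR_gt0. Qed.

Lemma sum_weight_gt0 n p b : 0 < \sum_(X : config n) weight p b X.
Proof.
rewrite (bigD1 [ffun=> true])//= ltr_wpDr ?weight_gt0// sumr_ge0// => X _.
exact/ltW/weight_gt0.
Qed.

Lemma pmfE n p b (X : config n) :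
  Defs.pmf p b X = weight p b X / \sum_(Y : config n) weight p b Y.
Proof. by rewrite /Defs.pmf /partition_function mulVKf// expf_neq0// pnatr_eq0. Qed.

Lemma pmf_ge0 n p b (X : config n) : 0 <= Defs.pmf p b X.
Proof. by rewrite pmfE divr_ge0// ltW ?weight_gt0 ?sum_weight_gt0. Qed.

Lemma probE n p b (A : pred (config n)) :
  prob p b A = (\sum_(X | A X) weight p b X) / \sum_(X : config n) weight p b X.
Proof. by rewrite /prob mulr_suml; apply: eq_bigr => X _; rewrite pmfE. Qed.

Lemma prob_ge0 n p b (A : pred (config n)) : 0 <= prob p b A.
Proof. by apply: sumr_ge0 => X _; exact: pmf_ge0. Qed.

Lemma le_prob n p b (A B : pred (config n)) :
  (forall X, A X -> B X) -> prob p b A <= prob p b B.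
Proof. by move=> AB; apply: ler_sum_subpred => // X _; exact: pmf_ge0. Qed.

Lemma prob_predT n p b : prob p b (xpredT : pred (config n)) = 1.
Proof. by rewrite probE divff ?lt0r_neq0 ?sum_weight_gt0. Qed.

Lemma probC n p b (A : pred (config n)) : 1 - prob p b A = prob p b (predC A).
Proof.
by apply/eqP; rewrite subr_eq -(prob_predT n p b) /prob (bigID A xpredT)/= addrC.
Qed.

Lemma prob_setU n p b (A B C : pred (config n)) :
  (forall X, A X -> B X || C X) -> prob p b A <= prob p b B + prob p b C.
Proof.
move=> ABC; apply: (@le_trans _ _ (prob p b (predU B C))); first exact: le_prob.
rewrite /prob (bigID B)/= lerD//.
  by apply: ler_sum_subpred => [X _|X /andP[]//]; exact: pmf_ge0.
by apply: ler_sum_subpred => [X _|X /andP[/orP[->|]//]]; exact: pmf_ge0.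
Qed.

Lemma mean_itv n (X : config n) : (0 < n)%N -> -1 <= mean R X <= 1.
Proof.
move=> n0; rewrite mean_ups// /level.
have n0R : 0 < n%:R :> R by rewrite ltr0n.
have : (ups X)%:R / n%:R <= 1 :> R by rewrite ler_pdivrMr// mul1r ler_nat ups_le.
have : 0 <= (ups X)%:R / n%:R :> R by rewrite divr_ge0.
by move=> ? ?; rewrite -mulrA; apply/andP; split; lra.
Qed.

Lemma sum_weight_level n p b k : (0 < n)%N ->
  \sum_(X : config n | ups X == k) weight p b X =
  'C(n, k)%:R * expR (n%:R * (b * level R n k ^+ p)).
Proof.
move=> n0; rewrite -card_ups mulr_natl -sumr_const.
by apply: eq_big => // X /eqP <-; rewrite weightE// mean_ups.
Qed.

Lemma binomial_entropy n k : (0 < n)%N -> (k <= n)%N ->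
  'C(n, k)%:R <= 2 ^+ n * expR (- (n%:R * entropyI (level R n k))) <=
  n.+1%:R * 'C(n, k)%:R.
Proof.
move=> n0 kn; have c0 : 0 < (k ^ k * (n - k) ^ (n - k))%:R :> R.
  by rewrite ltr0n muln_gt0 !expn_gt0; case: k {kn} => [|k]; case: (n - _)%N.
rewrite -(ler_pM2r c0) -[X in _ && X](ler_pM2r c0) entropy_level// -!natrM !ler_nat.
by rewrite binomial_upper//= -mulnA binomial_lower.
Qed.

(** Configurations are grouped by their number of +1 spins. There are n + 1 groups, and one that
    meets [A] has total weight at most 2^n exp(n M), since [H] depends only on the mean. *)
Lemma sum_weight_upper n p b M (A : pred (config n)) : (0 < n)%N ->
  (forall X, A X -> H b p (mean R X) <= M) ->
  \sum_(X | A X) weight p b X <= n.+1%:R * (2 ^+ n * expR (n%:R * M)).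
Proof.
move=> n0 AM.
rewrite (partition_big (fun X : config n => inord (ups X) : 'I_n.+1) xpredT)//=.
rewrite -[in leRHS](card_ord n.+1) mulr_natl -sumr_const ler_sum// => k _.
have inordE (X : config n) : (inord (ups X) == k) = (ups X == k).
  by rewrite -val_eqE/= inordK// ltnS ups_le.
have [X /andP[AX /eqP Xk]|noX] := pickP [pred X | A X & inord (ups X) == k]; last first.
  rewrite big_pred0 => [|X]; first by rewrite mulr_ge0 ?exprn_ge0 ?expR_ge0.
  exact: noX.
have kn : (k <= n)%N by rewrite -ltnS.
apply: (@le_trans _ _ (\sum_(X : config n | ups X == k) weight p b X)).
  by apply: ler_sum_subpred => [Y _|Y /andP[_]]; rewrite ?inordE// ltW// weight_gt0.
have /eqP upsX : ups X == k by rewrite -inordE Xk.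
rewrite sum_weight_level//.
have /andP[Cn _] := binomial_entropy n0 kn.
apply: (le_trans (ler_wpM2r (expR_ge0 _) Cn)).
rewrite -mulrA -expRD ler_pM2l ?exprn_gt0// ler_expR -mulrN -mulrDr ler_wpM2l//.
by have := AM _ AX; rewrite mean_ups// upsX /H addrC.
Qed.

Lemma sum_weight_lower n p b (X0 : config n) (A : pred (config n)) : (0 < n)%N ->
  (forall X, mean R X = mean R X0 -> A X) ->
  2 ^+ n * expR (n%:R * H b p (mean R X0)) <= n.+1%:R * \sum_(X | A X) weight p b X.
Proof.
move=> n0 AX0.
apply: (@le_trans _ _ (n.+1%:R * \sum_(X : config n | ups X == ups X0) weight p b X)); last first.
  rewrite ler_wpM2l//; apply: ler_sum_subpred => [X _|X /eqP XX0]; first exact/ltW/weight_gt0.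
  by apply: AX0; rewrite !mean_ups// XX0.
rewrite sum_weight_level// mulrA.
have /andP[_ Cn] := binomial_entropy n0 (ups_le X0).
apply: le_trans (ler_wpM2r (expR_ge0 _) Cn).
by rewrite -mulrA -expRD mean_ups// /H mulrBr addrC.
Qed.

(** The level of [X0] alone bounds the normalizing sum from below; numerator and denominator each
    cost a factor n + 1. *)
Lemma probM_upper n p b M (X0 : config n) (A : pred (config n)) : (0 < n)%N ->
  (forall X, A X -> H b p (mean R X) <= M) ->
  prob p b A <= n.+1%:R ^+ 2 * expR (n%:R * (M - H b p (mean R X0))).
Proof.
move=> n0 AM; rewrite probE ler_pdivrMr ?sum_weight_gt0//.
apply: le_trans (sum_weight_upper n0 AM) _.
have := @sum_weight_lower n p b X0 xpredT n0 (fun _ _ => isT).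
move=> /(ler_wpM2l (expR_ge0 (n%:R * (M - H b p (mean R X0))))) /(ler_wpM2l (ler0n _ n.+1)).
congr (_ <= _); last by ring.
rewrite [expR _ * _]mulrCA -expRD; congr (_ * (_ * expR _)); ring.
Qed.

Lemma probM_lower n p b M (X0 : config n) (A : pred (config n)) : (0 < n)%N ->
  (forall x, -1 <= x <= 1 -> H b p x <= M) ->
  (forall X, mean R X = mean R X0 -> A X) ->
  expR (n%:R * (H b p (mean R X0) - M)) <= n.+1%:R ^+ 2 * prob p b A.
Proof.
move=> n0 HM AX0; rewrite probE mulrA ler_pdivlMr ?sum_weight_gt0//.
have := @sum_weight_upper n p b M xpredT n0 (fun X _ => HM _ (mean_itv X n0)).
move=> /(ler_wpM2l (expR_ge0 (n%:R * (H b p (mean R X0) - M)))) /le_trans; apply.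
have := @sum_weight_lower n p b X0 A n0 AX0 => /(ler_wpM2l (ler0n _ n.+1)).
congr (_ <= _); last by ring.
rewrite [RHS]mulrCA [expR _ * (_ * _)]mulrCA -expRD; congr (_ * (_ * expR _)); ring.
Qed.

Lemma polynomial_le_exp (eta : R) : 0 < eta ->
  \forall n \near \oo, n.+1%:R ^+ 2 <= expR (n%:R * eta).
Proof.
move=> eta0; near=> n.
have e4 : expR (n%:R * eta) = expR (n%:R * (eta / 4)) ^+ 4.
  by rewrite -expRM_natl; congr expR; field.
(* This makes (n eta / 4)^2 at least n, so that (1 + n eta / 4)^2 exceeds n + 1. *)
have n16 : 16 / eta ^+ 2 <= n%:R by near: n; exact: nbhs_infty_ger.
have e1 := expR_ge1Dx (n%:R * (eta / 4)).
rewrite e4 (exprM _ 2 2) lerXn2r ?nnegrE ?exprn_ge0 ?expR_ge0//.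
have n0 : 0 <= n%:R * eta by rewrite mulr_ge0// ltW.
apply: (@le_trans _ _ ((1 + n%:R * (eta / 4)) ^+ 2)); last first.
  by rewrite lerXn2r ?nnegrE ?expR_ge0//; lra.
rewrite ler_pdivrMr ?exprn_gt0// in n16.
have : n%:R * 16 <= n%:R * (n%:R * eta ^+ 2) by rewrite ler_wpM2l.
rewrite -natr1; nra.
Unshelve. all: by end_near.
Qed.

End LargeDeviations.

(** * Continuity and derivatives of I and H *)

Section FreeEnergy.
Variable R : realType.
Implicit Types (n p : nat) (b x y M : R).

(** For x > 0, apply ln y < y to y = 1 / sqrt x. This gives the continuity of x ln x at 0. *)
Lemma normM_ln_le x : `|x| <= 1 -> `|x * ln x| <= 2 * Num.sqrt `|x|.
Proof.
move=> x1; have [x0|x0] := leP x 0.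
  by rewrite ln0// mulr0 normr0 mulr_ge0// sqrtr_ge0.
move: x1; rewrite (gtr0_norm x0) => x1.
rewrite normrM (gtr0_norm x0) ler0_norm; last by rewrite ln_le0.
have s0 : 0 < Num.sqrt x by rewrite sqrtr_gt0.
rewrite -{1 2}(sqr_sqrtr (ltW x0)) lnXn// expr2.
have := ln_sublinear (x := (Num.sqrt x)^-1); rewrite invr_gt0 => /(_ s0).
rewrite lnV ?posrE// => h.
have : Num.sqrt x * - ln (Num.sqrt x) < 1 by rewrite mulrC -ltr_pdivlMr// div1r.
by rewrite -mulr_natl; nra.
Qed.

(** Since [ln] is 0 on nonpositive numbers, continuity holds on the whole line, so that [H] is
    continuous at -1 and 1 without one-sided limits. *)
Lemma continuous_xlnx : continuous (fun x : R => x * ln x).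
Proof.
move=> x; have [x0|x0|->] := ltgtP x 0.
- apply: (@near_cst_continuous _ _ 0); near=> y; rewrite ln0 ?mulr0//.
  by apply: ltW; near: y; exact: lt_nbhsl.
- by apply: continuousM; [exact: cvg_id|exact: continuous_ln].
- rewrite /continuous_at mul0r; apply/cvgr0Pnorm_le => e e0.
  have d0 : 0 < Num.min 1 ((e / 2) ^+ 2) by rewrite lt_min ltr01 exprn_gt0// divr_gt0.
  apply: filterS (@nbhs0_lt R R^o _ d0) => z z1.
  move: z1; rewrite lt_min => /andP[z1 ze].
  have e2 : 0 <= e / 2 by rewrite divr_ge0// ltW.
  have : Num.sqrt `|z| <= e / 2.
    by rewrite -[leRHS]ger0_norm// -(sqrtr_sqr (e / 2)) ler_sqrt ?ltW// exprn_gt0// divr_gt0.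
  by have := normM_ln_le (ltW z1); lra.
Unshelve. all: by end_near. Qed.

Lemma continuous_entropyI : continuous (@entropyI R).
Proof.
suff cf : continuous (fun x : R => (1 + x) * ln (1 + x) + (1 - x) * ln (1 - x)).
  by move=> x; apply: (@continuousM _ _ (cst 2^-1) _ x _ (cf x)); exact: cvg_cst.
move=> x; apply: (@continuousD _ _ _ (fun x => (1 + x) * ln (1 + x))
  (fun x => (1 - x) * ln (1 - x))).
  apply: (@continuous_comp _ _ _ (fun x => 1 + x) (fun x : R => x * ln x)) => //;
    last exact: continuous_xlnx.
  by apply: continuousD; [exact: cvg_cst|exact: cvg_id].
apply: (@continuous_comp _ _ _ (fun x => 1 - x) (fun x : R => x * ln x)) => //;
    last exact: continuous_xlnx.
by apply: continuousB; [exact: cvg_cst|exact: cvg_id].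
Qed.

Lemma continuous_H b p : continuous (H b p).
Proof.
move=> x; apply: (@continuousB _ _ _ (fun x => b * x ^+ p)); last exact: continuous_entropyI.
by apply: (@continuousM _ _ (cst b) _ x _ (@exprn_continuous R p x)); exact: cvg_cst.
Qed.

Lemma regular_scaleE (a c : R) : a *: (c : R^o) = a * c.
Proof. by []. Qed.

(** Real-valued counterpart of [artanh], suited to differentiation on (-1, 1). *)
Definition artanhR x : R := 2^-1 * (ln (1 + x) - ln (1 - x)).

Lemma is_derive1D (s x : R) : is_derive x 1 (fun x => 1 + s * x) s.
Proof.
have := is_deriveD (is_derive_cst (1 : R) x 1) (is_deriveZ s (is_derive_id x 1)).
have -> : cst 1 + s *: id = (fun x => 1 + s * x) by apply/funext.
by move/is_derive_eq; apply; rewrite add0r [_ *: _]mulr1.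
Qed.

Lemma is_derive_ln1D (s x : R) : 0 < 1 + s * x ->
  is_derive x 1 (fun x => ln (1 + s * x)) (s / (1 + s * x)).
Proof.
move=> x0; have d1 := is_derive1D s x.
apply: (is_derive_eq (@is_derive1_comp _ (@ln R) _ x _ _ (is_derive1_ln x0) d1)).
by rewrite mulrC.
Qed.

Lemma is_derive_artanhR x : -1 < x < 1 -> is_derive x 1 artanhR (1 - x ^+ 2)^-1.
Proof.
move=> /andP[x1 x2].
have p1 : 0 < 1 + 1 * x by lra.
have p2 : 0 < 1 + -1 * x by lra.
have := is_deriveZ 2^-1 (is_deriveB (is_derive_ln1D p1) (is_derive_ln1D p2)).
have -> : artanhR = 2^-1 *: ((fun x => ln (1 + 1 * x)) - (fun x => ln (1 + -1 * x))).
  by apply/funext => y; rewrite /artanhR !fctE mul1r mulN1r.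
move/is_derive_eq; apply; rewrite !regular_scaleE.
by field; apply/and3P; split; apply/negP => /eqP; nra.
Qed.

Lemma is_derive_entropyI x : -1 < x < 1 -> is_derive x 1 (@entropyI R) (artanhR x).
Proof.
move=> /andP[x1 x2].
have p1 : 0 < 1 + 1 * x by lra.
have p2 : 0 < 1 + -1 * x by lra.
have := is_deriveZ 2^-1 (is_deriveD
  (is_deriveM (is_derive1D 1 x) (is_derive_ln1D p1))
  (is_deriveM (is_derive1D (-1) x) (is_derive_ln1D p2))).
have -> : @entropyI R = 2^-1 *:
    ((fun x => 1 + 1 * x) * (fun x => ln (1 + 1 * x)) +
     (fun x => 1 + -1 * x) * (fun x => ln (1 + -1 * x))).
  by apply/funext => y; rewrite /entropyI !fctE mul1r mulN1r.
move/is_derive_eq; apply; rewrite /artanhR !regular_scaleE mul1r mulN1r.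
by field; apply/andP; split; apply/negP => /eqP; nra.
Qed.

Lemma is_derive_exprn p x : is_derive x 1 (fun x => x ^+ p : R) (p%:R * x ^+ p.-1).
Proof.
have := is_deriveX p (is_derive_id x (1 : R)).
have -> : (id : R -> R) ^+ p = (fun x => x ^+ p) by apply/funext => y; rewrite exprfctE.
by move/is_derive_eq; apply; rewrite regular_scaleE mulr1.
Qed.

Lemma is_derive_H b p x : -1 < x < 1 ->
  is_derive x 1 (H b p) (b * (p%:R * x ^+ p.-1) - artanhR x).
Proof.
move=> x1.
have := is_deriveB (is_deriveZ b (is_derive_exprn p x)) (is_derive_entropyI x1).
by have -> : b *: (fun x => x ^+ p) - @entropyI R = H b p by apply/funext.
Qed.

End FreeEnergy.

(** * The shape of [stat_beta] *)

Section StationaryPoints.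
Variable R : realType.
Implicit Types (n p : nat) (b x y M : R).

Lemma MVT_is_derive (f df : R -> R) (u v : R) : u < v ->
  (forall x, u <= x <= v -> is_derive x 1 f (df x)) ->
  exists2 c, u < c < v & f v - f u = df c * (v - u).
Proof.
move=> uv dfE; have [||c] := @MVT R f df u v uv.
- by move=> x; rewrite in_itv/= => /andP[ux xv]; apply: dfE; rewrite !ltW.
- apply: derivable_within_continuous => x; rewrite in_itv/= => xuv.
  by have [] := dfE x xuv.
- by rewrite in_itv/=; exists c.
Qed.

(** The endpoints -1 and 1 are allowed: [H] is continuous there although its derivative blows up. *)
Lemma MVT_H b p (u v : R) : -1 <= u -> u < v -> v <= 1 ->
  exists2 c, u < c < v &
    H b p v - H b p u = (b * (p%:R * c ^+ p.-1) - artanhR c) * (v - u).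
Proof.
move=> u1 uv v1; have [||c] := @MVT R (H b p) (fun x => b * (p%:R * x ^+ p.-1) - artanhR x) u v uv.
- move=> x; rewrite in_itv/= => /andP[ux xv].
  by apply: is_derive_H; rewrite (le_lt_trans u1 ux) (lt_le_trans xv v1).
- by apply: continuous_subspaceT; exact: continuous_H.
- by rewrite in_itv/=; exists c.
Qed.

Lemma entropyI0 : entropyI (0 : R) = 0.
Proof. by rewrite /entropyI addr0 subr0 ln1 !mulr0 addr0 mulr0. Qed.

Lemma H_at0 b p : (0 < p)%N -> H b p 0 = 0.
Proof. by move=> p0; rewrite /H expr0n gtn_eqF// mulr0 entropyI0 subr0. Qed.

Lemma artanhR0 : artanhR (0 : R) = 0.
Proof. by rewrite /artanhR addr0 subr0 subrr mulr0. Qed.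

Lemma le_artanhR x : 0 <= x < 1 -> x <= artanhR x.
Proof.
move=> /andP[]; rewrite le_eqVlt => /predU1P[<-|x0 x1]; first by rewrite artanhR0.
have [|c /andP[c0 cx]] := @MVT_is_derive (@artanhR R) (fun x => (1 - x ^+ 2)^-1) 0 x x0.
  by move=> y /andP[y0 yx]; apply: is_derive_artanhR; apply/andP; split; lra.
rewrite artanhR0 !subr0 => ->; apply: ler_peMl; first exact: ltW.
rewrite invf_ge1; last by nra.
by have := sqr_ge0 c; lra.
Qed.

(* H_b has derivative p x^(p-1) (b - stat_beta p x), so that x is a stationary
   point of H_b exactly for b = stat_beta p x. *)
Definition stat_beta p x : R := artanhR x / (p%:R * x ^+ p.-1).

(** In this factored form the sign of an increment of [H] is the sign of [b - stat_beta p c]. *)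
Lemma MVT_H_stat b p (u v : R) : (0 < p)%N -> 0 <= u -> u < v -> v <= 1 ->
  exists2 c, u < c < v &
    H b p v - H b p u = p%:R * c ^+ p.-1 * (v - u) * (b - stat_beta p c).
Proof.
move=> p0 u0 uv v1; have [|c /andP[uc cv] ->] := @MVT_H b p u v _ uv v1; first by lra.
exists c; first by rewrite uc.
have cn0 : c ^+ p.-1 != 0 by rewrite expf_neq0// gt_eqF// (le_lt_trans u0).
have pn0 : p%:R != 0 :> R by rewrite pnatr_eq0 -lt0n.
by rewrite /stat_beta; field; rewrite pn0 cn0.
Qed.

Lemma pmul_expr_gt0 p (c d : R) : (0 < p)%N -> 0 < c -> 0 < d ->
  0 < p%:R * c ^+ p.-1 * d.
Proof. by move=> p0 c0 d0; rewrite !mulr_gt0 ?exprn_gt0 ?ltr0n. Qed.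

Lemma ltr_H_decr b p (u v : R) : (0 < p)%N -> 0 <= u -> u < v -> v <= 1 ->
  (forall x, u < x < v -> b < stat_beta p x) -> H b p v < H b p u.
Proof.
move=> p0 u0 uv v1 bx; have [c cuv HE] := MVT_H_stat b p0 u0 uv v1.
rewrite -subr_lt0 HE pmulr_rlt0 ?subr_lt0 ?bx//.
by move: cuv => /andP[uc cv]; rewrite pmul_expr_gt0 ?subr_gt0// (le_lt_trans u0).
Qed.

(* Up to a positive factor, this is the derivative of [stat_beta p]. *)
Definition stat_beta_slope p x : R := x / (1 - x ^+ 2) - (p%:R - 1) * artanhR x.

Lemma is_derive_stat_beta p x : (0 < p)%N -> 0 < x < 1 ->
  is_derive x 1 (stat_beta p) (stat_beta_slope p x / (p%:R * x ^+ p)).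
Proof.
case: p => // p _ /andP[x0 x1].
have x11 : -1 < x < 1 by apply/andP; split; lra.
have pn0 : p.+1%:R != 0 :> R by rewrite pnatr_eq0.
have d2 : is_derive x 1 (p.+1%:R *: (fun x : R => x ^+ p)) (p.+1%:R * (p%:R * x ^+ p.-1)).
  exact: (is_deriveZ p.+1%:R (is_derive_exprn p x)).
have nz : (p.+1%:R *: (fun x : R => x ^+ p)) x != 0.
  by rewrite scalrfctE regular_scaleE mulf_neq0// expf_neq0// gt_eqF.
have := is_deriveM (is_derive_artanhR x11) (is_deriveV nz d2).
have -> : @artanhR R * (fun y => ((p.+1%:R *: (fun x : R => x ^+ p)) y)^-1) = stat_beta p.+1.
  by apply/funext.
move/is_derive_eq; apply; rewrite scalrfctE !regular_scaleE /stat_beta_slope.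
have x2 : 1 - x ^+ 2 != 0 by apply/negP => /eqP; nra.
have xn : x != 0 by rewrite gt_eqF.
(* Here [p] is the predecessor of the original exponent; both sides vanish when it is 0. *)
have -> : p%:R * x ^+ p.-1 = p%:R * x ^+ p / x.
  by case: (p) => [|q]; rewrite ?mul0r// exprSr mulrA mulfK.
have xp : x ^+ p != 0 by rewrite expf_neq0.
rewrite -exprVn !exprS -natr1 in pn0 *.
by field; rewrite x2 pn0 xn xp.
Qed.

Lemma is_derive_stat_beta_slope p x : -1 < x < 1 ->
  is_derive x 1 (stat_beta_slope p)
    ((p%:R * x ^+ 2 - (p%:R - 2)) / (1 - x ^+ 2) ^+ 2).
Proof.
move=> x1; have d1 : is_derive x 1 (fun y : R => 1 - y ^+ 2) (- (2 * x)).
  have := is_deriveB (is_derive_cst (1 : R) x 1) (is_derive_exprn 2 x).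
  by move/is_derive_eq; apply; rewrite sub0r.
have x2 : 1 - x ^+ 2 != 0 by move/andP: x1 => [? ?]; apply/negP => /eqP; nra.
have := is_deriveB (is_deriveM (is_derive_id x (1 : R))
    (@is_deriveV R (fun y => 1 - y ^+ 2) x _ _ x2 d1))
  (is_deriveZ (p%:R - 1) (is_derive_artanhR x1)).
have -> : id * (fun y => (1 - y ^+ 2)^-1) - (p%:R - 1) *: @artanhR R = stat_beta_slope p.
  by apply/funext.
move/is_derive_eq; apply; rewrite !regular_scaleE -exprVn.
by field.
Qed.

(** The slope vanishes at 0 and its derivative has the sign of q(x) = p x^2 - (p - 2). A nonnegative
    slope at [u] forces q >= 0 somewhere before [u], hence q > 0 beyond [u], where the slope then
    grows strictly. *)
Lemma stat_beta_slope_gt0 p (u v : R) : 0 < u -> u < v -> v < 1 ->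
  0 <= stat_beta_slope p u -> 0 < stat_beta_slope p v.
Proof.
move=> u0 uv v1 su.
pose q x : R := p%:R * x ^+ 2 - (p%:R - 2).
have dS x : -1 < x < 1 -> is_derive x 1 (stat_beta_slope p) (q x / (1 - x ^+ 2) ^+ 2).
  exact: is_derive_stat_beta_slope.
have den x : -1 < x < 1 -> 0 < (1 - x ^+ 2) ^+ 2.
  by move=> /andP[? ?]; rewrite exprn_gt0//; nra.
have [|c /andP[c0 cu]] := @MVT_is_derive (stat_beta_slope p)
  (fun x => q x / (1 - x ^+ 2) ^+ 2) 0 u u0.
  by move=> x /andP[x0 xu]; apply: dS; apply/andP; split; lra.
have -> : stat_beta_slope p 0 = 0 by rewrite /stat_beta_slope mul0r artanhR0 mulr0 subrr.
rewrite !subr0 => sE; have qc : 0 <= q c.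
  by move: su; rewrite sE pmulr_lge0// pmulr_lge0// invr_gt0 den//; apply/andP; split; lra.
have [|d /andP[ud dv]] := @MVT_is_derive (stat_beta_slope p)
  (fun x => q x / (1 - x ^+ 2) ^+ 2) u v uv.
  by move=> x /andP[x0 xv]; apply: dS; apply/andP; split; lra.
have qd : 0 < q d.
  have [p0|p0] := posnP p; first by move: (ltr0n R 2); rewrite /q p0/=; lra.
  apply: le_lt_trans qc _; rewrite /q ltrD2r ltr_pM2l ?ltr0n//.
  by rewrite ltrXn2r// ?nnegrE; lra.
have : 0 < q d / (1 - d ^+ 2) ^+ 2 * (v - u).
  by rewrite mulr_gt0 ?subr_gt0// divr_gt0// den//; apply/andP; split; lra.
by lra.
Qed.

(** By the mean value theorem the slope is nonnegative at some [w] between [u] and [v], and from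
    there on it stays positive. *)
Lemma stat_beta_incr p (u v : R) : (0 < p)%N -> 0 < u -> u < v -> v < 1 ->
  stat_beta p u <= stat_beta p v ->
  exists2 w, u < w < v &
    {in `[w, 1[ &, {homo stat_beta p : x y / x < y}}.
Proof.
move=> p0 u0 uv v1 suv.
have [|w /andP[uw wv] wE] := @MVT_is_derive (stat_beta p)
  (fun x => stat_beta_slope p x / (p%:R * x ^+ p)) u v uv.
  by move=> x /andP[ux xv]; apply: is_derive_stat_beta => //; apply/andP; split; lra.
have den x : 0 < x -> 0 < p%:R * x ^+ p by move=> x0; rewrite mulr_gt0 ?exprn_gt0 ?ltr0n.
have sw : 0 <= stat_beta_slope p w.
  have : 0 <= stat_beta p v - stat_beta p u by rewrite subr_ge0.
  by rewrite wE pmulr_lge0 ?subr_gt0// pmulr_lge0// invr_gt0 den//; lra.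
exists w; first by rewrite uw.
move=> x y; rewrite !in_itv/= => /andP[wx x1] /andP[wy y1] xy.
have [|z /andP[xz zy] zE] := @MVT_is_derive (stat_beta p)
  (fun x => stat_beta_slope p x / (p%:R * x ^+ p)) x y xy.
  by move=> z /andP[xz zy]; apply: is_derive_stat_beta => //; apply/andP; split; lra.
rewrite -subr_gt0 zE pmulr_lgt0 ?subr_gt0// divr_gt0//; last by rewrite den//; lra.
by apply: (@stat_beta_slope_gt0 _ w) => //; lra.
Qed.

(** As artanh x >= x and x^(p-1) <= x^2, [stat_beta p x] is at least 1 / (p x); [d] is the point
    where this bound equals |K| + 1. *)
Lemma stat_beta_near0 p (K : R) : (3 <= p)%N ->
  exists2 d, 0 < d < 1 & forall x, 0 < x < d -> K < stat_beta p x.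
Proof.
move=> p3; have p0 : 0 < p%:R :> R by rewrite ltr0n (leq_trans _ p3).
pose d := (p%:R * (`|K| + 1))^-1.
have K0 := normr_ge0 K.
have pK : 1 < p%:R * (`|K| + 1).
  apply: (@lt_le_trans _ _ (p%:R * 1)); first by rewrite mulr1 ltr1n (leq_trans _ p3).
  by rewrite ler_pM2l //; lra.
have d1 : d < 1 by rewrite invf_lt1 //; apply: lt_trans pK.
exists d; first by rewrite d1 andbT invr_gt0 (lt_trans _ pK).
move=> x /andP[x0 xd].
have x1 : x < 1 by apply: lt_trans xd d1.
have xp : x ^+ p.-1 <= x ^+ 2.
  by rewrite ler_wiXn2l ?ltW//; case: (p) p3 => // -[].
have xp0 : 0 < x ^+ p.-1 by rewrite exprn_gt0.
rewrite ltr_pdivlMr ?mulr_gt0//.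
apply: lt_le_trans (le_artanhR _); last by rewrite ltW.
have : x * (p%:R * (`|K| + 1)) < 1 by rewrite -ltr_pdivlMr ?div1r//; lra.
move=> xK; have KK : K <= `|K| := ler_norm K.
apply: (@le_lt_trans _ _ (`|K| * (p%:R * x ^+ 2))).
  apply: (@le_trans _ _ (`|K| * (p%:R * x ^+ p.-1))).
    by rewrite ler_wpM2r// mulr_ge0 ?ltW.
  by rewrite ler_wpM2l// ler_wpM2l// ltW.
have : 0 < p%:R * x by rewrite mulr_gt0.
by rewrite expr2; nra.
Qed.

End StationaryPoints.

(** * The threshold and the maximizer of H *)

Section Maximizer.
Variables (R : realType) (p : nat).
Hypothesis p_ge3 : (3 <= p)%N.
Implicit Types (b x y M : R).

Let p_gt0 : (0 < p)%N. Proof. exact: leq_trans p_ge3. Qed.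

Lemma entropyIN x : entropyI (- x) = entropyI x.
Proof. by rewrite /entropyI opprK; congr (_ * _); exact: addrC. Qed.

Lemma le_H_norm b x : 0 <= b -> H b p x <= H b p `|x|.
Proof.
move=> b0; have [x0|x0] := leP 0 x; first by rewrite ger0_norm.
rewrite (ltr0_norm x0) /H entropyIN lerD2r ler_wpM2l//.
by rewrite -(ltr0_norm x0) -normrX ler_norm.
Qed.

Lemma stat_beta_gt0 x : 0 < x < 1 -> 0 < stat_beta p x.
Proof.
move=> /andP[x0 x1]; apply: divr_gt0.
  by apply: (lt_le_trans x0); rewrite le_artanhR// ltW.
by rewrite mulr_gt0 ?exprn_gt0 ?ltr0n.
Qed.

Lemma entropyI_ge0 x : -1 <= x <= 1 -> 0 <= entropyI x.
Proof.
move=> /andP[x1 x2]; have : entropyI x = entropyI `|x|.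
  by have [?|?] := leP 0 x; [rewrite ger0_norm|rewrite ltr0_norm// entropyIN].
move=> ->; have n1 : `|x| <= 1 by rewrite ler_norml x1.
have := normr_ge0 x; rewrite le_eqVlt => /predU1P[<-|n0]; first by rewrite entropyI0.
(* The entropy is minus [H] at parameter 0, which lies below [stat_beta] on (0, 1). *)
have : H 0 p `|x| < H 0 p 0.
  by apply: ltr_H_decr => // y /andP[y0 y1]; apply: stat_beta_gt0; rewrite y0 (lt_le_trans y1).
by rewrite H_at0// /H mul0r sub0r oppr_lt0 => /ltW.
Qed.

Lemma entropyI1 : entropyI (1 : R) = ln 2.
Proof.
rewrite /entropyI subrr mul0r addr0 (_ : 1 + 1 = 2 :> R)// mulrA.
by rewrite mulVf ?pnatr_eq0// mul1r.
Qed.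

Lemma sup_H_eq0 b : 0 <= b -> (forall x, -1 <= x <= 1 -> H b p x <= 0) ->
  sup (H b p @` `[-1, 1]) = 0.
Proof.
move=> b0 Hle0; have zero : (H b p @` `[-1, 1]) 0.
  by exists 0; rewrite ?H_at0//= in_itv/= lerN10 ler01.
have ub : ubound (H b p @` `[-1, 1]) 0.
  by move=> _ [x /= + <-]; rewrite in_itv/=; exact: Hle0.
apply/eqP; rewrite eq_le ge_sup ?ub_le_sup//; first by exists 0.
by exists 0.
Qed.

Lemma H_le_sup0 b x : 0 <= b -> sup (H b p @` `[-1, 1]) = 0 ->
  -1 <= x <= 1 -> H b p x <= 0.
Proof.
move=> b0 s0 x1; rewrite -s0; apply: ub_le_sup; last by exists x.
(* [b] bounds the set because I >= 0; an upper bound is what lets [sup] dominate its elements. *)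
exists b => _ [y /= + <-]; rewrite in_itv/= => y1.
have /andP[ym yM] := y1.
have : b * y ^+ p <= b * 1.
  rewrite ler_wpM2l// (le_trans (ler_norm _))// normrX exprn_ile1//.
  by rewrite ler_norml ym.
by have := entropyI_ge0 y1; rewrite /H; lra.
Qed.

(** The set contains 0, and H_b(1) = b - ln 2 bounds it by ln 2. *)
Lemma has_sup_betastar : has_sup [set b : R | 0 <= b /\ sup (H b p @` `[-1, 1]) = 0].
Proof.
split.
  exists 0; split => //; apply: sup_H_eq0 => // x x1.
  by rewrite /H mul0r sub0r oppr_le0 entropyI_ge0.
exists (ln 2) => b [b0 s0]; have : H b p 1 <= 0.
  by apply: H_le_sup0 => //; apply/andP; split; lra.
by rewrite /H expr1n mulr1 entropyI1 subr_le0.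
Qed.

Lemma betastar_ge0 : 0 <= betastar R p.
Proof.
apply: ub_le_sup; first by have [] := has_sup_betastar.
split => //; apply: sup_H_eq0 => // x x1.
by rewrite /H mul0r sub0r oppr_le0 entropyI_ge0.
Qed.

Lemma H_gt0_exists b : betastar R p < b -> exists2 x, 0 < x <= 1 & 0 < H b p x.
Proof.
move=> bb; have b0 : 0 <= b := le_trans betastar_ge0 (ltW bb).
apply: contrapT => noX; move: bb; apply/negP; rewrite -leNgt.
apply: ub_le_sup; first by have [] := has_sup_betastar.
split => //; apply: sup_H_eq0 => // x /andP[xm xM].
rewrite leNgt; apply/negP => Hx; apply: noX; exists `|x|.
  rewrite normr_gt0 ler_norml xm xM !andbT.
  by apply/eqP => x0; move: Hx; rewrite x0 H_at0// ltxx.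
by rewrite (lt_le_trans Hx)// le_H_norm.
Qed.

(** If the value were h > 0, some [s] in the set would exceed [betastar - h], and since x^p <= 1 the
    value at [s] would still be positive. *)
Lemma H_betastar_le0 x : 0 <= x <= 1 -> H (betastar R p) p x <= 0.
Proof.
move=> /andP[x0 x1]; rewrite leNgt; apply/negP => h0.
have [s [s0 sup0] bs] := sup_adherent h0 has_sup_betastar.
have : H s p x <= 0 by apply: H_le_sup0 => //; apply/andP; split; lra.
have xp : 0 <= x ^+ p <= 1 by rewrite exprn_ge0// exprn_ile1.
move: bs; rewrite -/(betastar R p) /H in h0 * => bs.
have [sb|sb] := leP (betastar R p) s; first by nra.
by move/andP: xp => [xp0 xp1]; nra.
Qed.

Definition is_maximizer b m :=
  0 < m < 1 /\ forall x, x \in `[-1, 1]%R -> H b p x <= H b p m.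

Lemma is_maximizer_stat b m : is_maximizer b m -> stat_beta p m = b.
Proof.
move=> [/andP[m0 m1] mmax].
have m11 : -1 < m < 1 by apply/andP; split; lra.
have : is_derive m 1 (H b p) 0.
  have mI : m \in `]-1, 1[ by rewrite in_itv.
  apply: (@derive1_at_max R (H b p) (-1) 1 m _ _ mI); first by lra.
    by move=> t; rewrite in_itv/= => /(is_derive_H b p)[].
  move=> t; rewrite in_itv/= => /andP[t1 t2]; apply: mmax.
  by rewrite in_itv/= !ltW.
move=> d0; have d1 := is_derive_H b p m11.
have /eqP := etrans (esym (@derive_val _ _ _ _ _ _ _ d1)) (@derive_val _ _ _ _ _ _ _ d0).
rewrite subr_eq0 /stat_beta => /eqP <-.
by rewrite mulfK// mulf_neq0 ?pnatr_eq0 -?lt0n// expf_neq0// gt_eqF.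
Qed.

(** [H] rises from 0 at 0 to a positive value at [m], so [stat_beta] is below [b] somewhere before
    [m], and climbs back to [b] at [m]. *)
Lemma stat_beta_incr_past b m : 0 < m < 1 -> 0 < H b p m -> stat_beta p m = b ->
  exists2 w, 0 < w < m & {in `[w, 1[ &, {homo stat_beta p : x y / x < y}}.
Proof.
move=> /andP[m0 m1] Hm sm; have [c /andP[c0 cm]] := MVT_H_stat b p_gt0 (lexx 0) m0 (ltW m1).
rewrite H_at0// subr0 => HE; move: Hm; rewrite HE pmulr_rgt0; last first.
  by rewrite pmul_expr_gt0// subr_gt0.
rewrite subr_gt0 -[X in _ < X]sm => /ltW /(stat_beta_incr p_gt0 c0 cm m1)[w /andP[cw wm] winc].
by exists w => //; rewrite wm andbT (lt_trans c0).
Qed.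

(** Both points have [stat_beta] equal to [b], yet from the smaller one on [stat_beta] is strictly
    increasing. *)
Lemma is_maximizer_unique b m m' : 0 < H b p m ->
  is_maximizer b m -> is_maximizer b m' -> m = m'.
Proof.
move=> Hm mM m'M; have [m01 mmax] := mM; have [m'01 m'max] := m'M.
have Hm' : 0 < H b p m'.
  rewrite (lt_le_trans Hm)// m'max// in_itv/=.
  by move/andP: m01 => [? ?]; apply/andP; split; lra.
have sm := is_maximizer_stat mM; have sm' := is_maximizer_stat m'M.
wlog mm' : m m' Hm Hm' mM m'M m01 m'01 sm sm' mmax m'max / m < m'.
  move=> W; have [mm'|mm'|//] := ltgtP m m'; first exact: W.
  by symmetry; apply: W.
have [w /andP[w0 wm] inc] := stat_beta_incr_past m01 Hm sm.
have := inc m m'; rewrite sm sm' ltxx !in_itv/= (ltW wm).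
move/andP: m01 => [_ ->]; move/andP: m'01 => [_ ->].
by rewrite (ltW (lt_trans wm mm')) => /(_ isT isT mm').
Qed.

(** The derivative of [H] tends to minus infinity at 1; [d] is chosen so that artanh exceeds b p on
    (1 - d, 1). *)
Lemma H1_not_max b : 0 <= b -> exists2 x, 0 < x < 1 & H b p 1 < H b p x.
Proof.
move=> b0; pose d := expR (- (2 * (b * p%:R) + 1)).
have d0 : 0 < d := expR_gt0 _.
have bp : 0 <= b * p%:R by rewrite mulr_ge0.
have d1 : d < 1 by rewrite expR_lt1; lra.
exists (1 - d); first by apply/andP; split; lra.
have [|||c /andP[cd c1]] := @MVT_H R b p (1 - d) 1; [lra|lra|exact: lexx|].
move=> E; rewrite -subr_lt0 E pmulr_llt0; last by lra.
have ln1c : ln (1 - c) <= - (2 * (b * p%:R) + 1).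
  by rewrite -[leRHS]expRK -/d ler_ln ?posrE//; lra.
have ln1Dc : 0 <= ln (1 + c) by rewrite ln_ge0; lra.
have cp : c ^+ p.-1 <= 1 by rewrite exprn_ile1//; lra.
have : b * (p%:R * c ^+ p.-1) <= b * p%:R.
  by rewrite mulrA ler_piMr.
by rewrite /artanhR; lra.
Qed.

(** A maximizer over [0, 1] exists by compactness. It is not 0, where [H] vanishes, nor 1; passing
    to absolute values extends it to [-1, 1]. *)
Lemma mstarP b : betastar R p < b ->
  is_maximizer b (mstar b p) /\ 0 < H b p (mstar b p).
Proof.
move=> bb; have b0 : 0 <= b := le_trans betastar_ge0 (ltW bb).
have [x /andP[x0 x1] Hx] := H_gt0_exists bb.
have [|c] := @EVT_max R (H b p) 0 1 ler01.
  by apply: continuous_subspaceT; exact: continuous_H.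
rewrite in_itv/= => /andP[c0 c1] cmax.
have Hc : 0 < H b p c by rewrite (lt_le_trans Hx)// cmax// in_itv/= ltW.
have cM : is_maximizer b c.
  split.
    rewrite !lt_neqAle c0 c1 !andbT; apply/andP; split; apply/eqP.
      by move=> c0'; move: Hc; rewrite -c0' H_at0// ltxx.
    move=> c1'; have [y /andP[y0 y1]] := H1_not_max b0.
    by rewrite -c1' ltNge cmax// in_itv/= !ltW.
  move=> y; rewrite in_itv/= => y1; rewrite (le_trans (le_H_norm _ _))// cmax//.
  by rewrite in_itv/= normr_ge0 ler_norml.
have mM : is_maximizer b (mstar b p) by exact: (xgetPex 0 (ex_intro _ c cM)).
split => //; have [_ mmax] := mM; rewrite (lt_le_trans Hc)// mmax// in_itv/=.
by apply/andP; split; lra.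
Qed.

End Maximizer.

(** * Comparison of H at different points and parameters *)

Section Comparison.
Variables (R : realType) (p : nat).
Hypothesis p_ge3 : (3 <= p)%N.
Implicit Types (b x y M : R).

Let p_gt0 : (0 < p)%N. Proof. exact: leq_trans p_ge3. Qed.

Lemma mstar_itv b : betastar R p < b -> 0 < mstar b p < 1.
Proof. by case/(mstarP p_ge3) => -[]. Qed.

Lemma le_H_mstar b x : betastar R p < b -> -1 <= x <= 1 ->
  H b p x <= H b p (mstar b p).
Proof. by move=> /(mstarP p_ge3)[[_ mmax] _] x1; apply: mmax; rewrite in_itv. Qed.

Lemma H_mstar_gt0 b : betastar R p < b -> 0 < H b p (mstar b p).
Proof. by case/(mstarP p_ge3). Qed.

Lemma stat_beta_mstar b : betastar R p < b -> stat_beta p (mstar b p) = b.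
Proof. by case/(mstarP p_ge3) => /(is_maximizer_stat p_ge3). Qed.

Lemma stat_beta_incr_mstar b : betastar R p < b ->
  exists2 w, 0 < w < mstar b p & {in `[w, 1[ &, {homo stat_beta p : x y / x < y}}.
Proof.
by move=> bb; apply: stat_beta_incr_past (mstar_itv bb) (H_mstar_gt0 bb) (stat_beta_mstar bb).
Qed.

Lemma stat_beta_gt b x : betastar R p < b -> mstar b p < x < 1 -> b < stat_beta p x.
Proof.
move=> bb /andP[mx x1]; have [w /andP[w0 wm] inc] := stat_beta_incr_mstar bb.
rewrite -[ltLHS](stat_beta_mstar bb); apply: inc => //; rewrite in_itv/=.
  by rewrite (ltW wm) (lt_trans mx).
by rewrite x1 ltW// (lt_trans wm).
Qed.

Lemma mstar_lt b0 b : betastar R p < b0 -> b0 < b -> mstar b0 p < mstar b p.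
Proof.
move=> bb0 b0b; have bb := lt_trans bb0 b0b.
have /andP[m0 m1] := mstar_itv bb0.
rewrite ltNge le_eqVlt; apply/negP => /orP[/eqP mm|mm].
  by move: b0b; rewrite -(stat_beta_mstar bb) mm stat_beta_mstar// ltxx.
have : b < stat_beta p (mstar b0 p) by apply: stat_beta_gt => //; rewrite mm.
by rewrite stat_beta_mstar// => /lt_trans /(_ b0b); rewrite ltxx.
Qed.

Lemma H_decr_past_mstar b (u v : R) : betastar R p < b -> mstar b p <= u ->
  u < v -> v <= 1 -> H b p v < H b p u.
Proof.
move=> bb mu uv v1; have /andP[m0 _] := mstar_itv bb.
apply: ltr_H_decr => //; first exact: le_trans (ltW m0) mu.
by move=> x /andP[ux xv]; apply: stat_beta_gt => //; rewrite (le_lt_trans mu) ?(lt_le_trans xv).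
Qed.

(* The level set {stat_beta p > stat_beta p y} of the pseudolikelihood
   estimator has, besides the expected part (y, 1), a part near 0 where H_b is
   only bounded by H_b(0) = 0. *)
Lemma le_H_stat_beta_gt b (x y : R) : betastar R p < b ->
  mstar b p < y < 1 -> 0 < x < 1 -> stat_beta p y < stat_beta p x ->
  H b p x <= Num.max 0 (H b p y).
Proof.
move=> bb my /andP[x0 x1] xy; have /andP[y0 y1] := my; rewrite le_max.
have [yx|yx|<-] := ltgtP y x; last by rewrite lexx orbT.
  by rewrite (ltW (H_decr_past_mstar bb (ltW y0) yx (ltW x1))) orbT.
(* When x < y, [H] decreases on all of (0, x): if [stat_beta] were at most [b] at some z < x, it
   would be increasing from before x on, against the assumed order of its values at x and y. *)
rewrite -(H_at0 b p_gt0) ltW//; apply: ltr_H_decr => //; first exact: ltW.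
move=> z /andP[z0 zx].
rewrite ltNge; apply/negP => zb.
have by_ := stat_beta_gt bb my.
have [w /andP[_ wx] inc] := stat_beta_incr p_gt0 z0 zx x1
  (le_trans zb (ltW (lt_trans by_ xy))).
have : stat_beta p x < stat_beta p y.
  by apply: inc => //; rewrite in_itv/= ?y1 ?x1 ?ltW// (lt_trans wx).
by move/lt_trans => /(_ _ xy); rewrite ltxx.
Qed.

(** To the left of the mode the gap comes from compactness and uniqueness of the maximizer, to the
    right from the decrease of [H]. *)
Lemma mstar_gap b (e : R) : betastar R p < b -> 0 < e ->
  exists2 M, M < H b p (mstar b p) &
    forall x, -1 <= x <= 1 -> e <= `| `|x| - mstar b p| -> H b p x <= M.
Proof.
move=> bb e0; have /andP[m0 m1] := mstar_itv bb.
have b0 : 0 <= b := le_trans (betastar_ge0 R p_ge3) (ltW bb).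
have [mM Hm] := mstarP p_ge3 bb.
pose a := Num.max 0 (mstar b p - e).
have am : a < mstar b p by rewrite gt_max m0/=; lra.
have a0 : 0 <= a by rewrite le_max lexx.
have [|c] := @EVT_max R (H b p) 0 a a0.
  by apply: continuous_subspaceT; exact: continuous_H.
rewrite in_itv/= => /andP[c0 ca] cmax.
have Hc : H b p c < H b p (mstar b p).
  rewrite lt_neqAle le_H_mstar ?andbT//; last by apply/andP; split; lra.
  apply/eqP => cm; have c0' : c != 0.
    by apply/eqP => c0'; move: Hm; rewrite -cm c0' H_at0// ltxx.
  have cM : is_maximizer p b c.
    split; first by rewrite lt_neqAle eq_sym c0' c0; lra.
    by move=> x; rewrite in_itv/= cm; exact: le_H_mstar.
  by have := is_maximizer_unique p_ge3 Hm mM cM; lra.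
have Hmax x : -1 <= x <= 1 -> H b p x <= H b p `|x| by move=> _; exact: le_H_norm.
pose d := mstar b p + e.
have [d1|d1] := leP d 1; last first.
  exists (H b p c) => // x x1 ex; rewrite (le_trans (Hmax _ x1))// cmax//.
  rewrite in_itv/= normr_ge0/=; have n1 : `|x| <= 1 by rewrite ler_norml.
  move: ex; rewrite ler_normr => /orP[?|?]; first by rewrite /d in d1; lra.
  by rewrite /a le_max; apply/orP; right; lra.
exists (Num.max (H b p c) (H b p d)).
  by rewrite gt_max Hc/=; apply: H_decr_past_mstar => //; rewrite /d; lra.
move=> x x1 ex; rewrite (le_trans (Hmax _ x1))// le_max.
have n1 : `|x| <= 1 by rewrite ler_norml.
move: ex; rewrite ler_normr => /orP[ex|ex]; last first.
  rewrite cmax// in_itv/= normr_ge0/= /a le_max; apply/orP; right; lra.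
have : d <= `|x| by rewrite /d; lra.
rewrite le_eqVlt => /predU1P[->|dx]; first by rewrite lexx orbT.
by rewrite (ltW (H_decr_past_mstar bb _ dx n1)) ?orbT// /d; lra.
Qed.

(** Were the value 0, [mstar b p] would also maximize [H] at the threshold, and stationarity would
    give [b = betastar R p]. *)
Lemma H_betastar_mstar_lt0 b : betastar R p < b ->
  H (betastar R p) p (mstar b p) < 0.
Proof.
move=> bb; have /andP[m0 m1] := mstar_itv bb.
rewrite lt_neqAle H_betastar_le0 ?andbT//; last by apply/andP; split; lra.
apply/eqP => H0m.
have : is_maximizer p (betastar R p) (mstar b p).
  split; first by rewrite m0.
  move=> x; rewrite in_itv/= H0m => x1.
  rewrite (le_trans (le_H_norm p _ _)) ?betastar_ge0//.
  by apply: H_betastar_le0 => //; rewrite normr_ge0 ler_norml.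
move/(is_maximizer_stat p_ge3); rewrite stat_beta_mstar// => E.
by move: bb; rewrite E ltxx.
Qed.

Lemma H_mstar_le_sub b : betastar R p < b -> H b p (mstar b p) <= b - betastar R p.
Proof.
move=> bb; have /andP[m0 m1] := mstar_itv bb.
have : H (betastar R p) p (mstar b p) <= 0.
  by apply: H_betastar_le0 => //; apply/andP; split; lra.
have mp : mstar b p ^+ p <= 1 by rewrite exprn_ile1// ltW.
by rewrite /H => h; nra.
Qed.

End Comparison.

(** * Maximum likelihood in a finite exponential family *)

Section ExponentialFamily.
Variables (R : realType) (I : finType) (T : I -> R).
Implicit Types (i j k : I) (r s : R).

(* The reciprocal of the likelihood at r of the observation i, in the
   exponential family on I with sufficient statistic T. *)
Definition inv_lik i r : R := \sum_j expR (r * (T j - T i)).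

(** [is_mle] is convertible to this, with the likelihood as [f]. *)
Definition extended_argmax (f : R -> R) (b : \bar R) : Prop :=
  let no_max := forall r, exists r', f r < f r' in
  match b with
  | r%:E => forall r', f r' <= f r
  | +oo%E => no_max /\ f r @[r --> +oo] --> sup (range f)
  | -oo%E => no_max /\ f r @[r --> -oo] --> sup (range f)
  end.

Lemma inv_lik_ge i j r : expR (r * (T j - T i)) <= inv_lik i r.
Proof. by rewrite /inv_lik (bigD1 j)//= lerDl sumr_ge0// => k _; exact: expR_ge0. Qed.

Lemma inv_lik_ge1 i r : 1 <= inv_lik i r.
Proof. by have := inv_lik_ge i i r; rewrite subrr mulr0 expR0. Qed.

Lemma inv_lik_gt0 i r : 0 < inv_lik i r.
Proof. exact: lt_le_trans ltr01 (inv_lik_ge1 i r). Qed.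

Lemma inv_lik_ge_linear i j r : 1 + r * (T j - T i) <= inv_lik i r.
Proof. exact: le_trans (expR_ge1Dx _) (inv_lik_ge i j r). Qed.

Lemma inv_lik_shift i j r : inv_lik j r = expR (r * (T i - T j)) * inv_lik i r.
Proof.
rewrite /inv_lik mulr_sumr; apply: eq_bigr => k _; rewrite -expRD; congr expR; ring.
Qed.

Lemma is_derive_inv_lik i r :
  is_derive r 1 (inv_lik i) (\sum_j (T j - T i) * expR (r * (T j - T i))).
Proof.
have d1 j : is_derive r 1 (fun r => expR (r * (T j - T i)))
    ((T j - T i) * expR (r * (T j - T i))).
  have dlin : is_derive r 1 (fun r => r * (T j - T i)) (T j - T i).
    have := is_deriveM (is_derive_id r (1 : R)) (is_derive_cst (T j - T i) r 1).
    have -> : id * cst (T j - T i) = (fun r => r * (T j - T i)) by apply/funext.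
    by move/is_derive_eq; apply; rewrite scaler0 add0r [_ *: _]mulr1.
  have := @is_derive1_comp _ (@expR R) _ r _ _ (is_derive_expR _) dlin.
  by move/is_derive_eq; apply; rewrite mulrC.
have -> : inv_lik i = \sum_j (fun r => expR (r * (T j - T i))).
  by apply/funext => s; rewrite fct_sumE.
rewrite unlock /reducebig; elim: (index_enum I) => [|j l ih] /=; first exact: is_derive_cst.
exact: is_deriveD.
Qed.

Lemma continuous_inv_lik i : continuous (inv_lik i).
Proof.
move=> r; apply: differentiable_continuous; apply/derivable1_diffP.
by have [] := is_derive_inv_lik i r.
Qed.

(** The likelihood equation: the expectation of [T] under the parameter [r] is [T i]. *)
Lemma inv_lik_min_stationary i r : (forall s, inv_lik i r <= inv_lik i s) ->
  \sum_j (T j - T i) * expR (r * (T j - T i)) = 0.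
Proof.
move=> rmin; have rI : r \in `](r - 1), (r + 1)[ by rewrite in_itv/=; apply/andP; split; lra.
have d0 : is_derive r 1 (inv_lik i) 0.
  apply: (@derive1_at_min R (inv_lik i) (r - 1) (r + 1) r _ _ rI) => //; first by lra.
  by move=> t _; have [] := is_derive_inv_lik i t.
have d1 := is_derive_inv_lik i r.
exact: etrans (esym (@derive_val _ _ _ _ _ _ _ d1)) (@derive_val _ _ _ _ _ _ _ d0).
Qed.

(** The linear lower bounds through [j] and [k] make [inv_lik i] exceed its value at 0 outside
    [-A, A], so a minimum over this interval is global. *)
Lemma inv_lik_argmin i j k : T j < T i -> T i < T k ->
  exists r, forall s, inv_lik i r <= inv_lik i s.
Proof.
move=> ji ik; pose g := inv_lik i 0.
have g0 : 0 < g := inv_lik_gt0 i 0.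
have dj : 0 < T i - T j by rewrite subr_gt0.
have dk : 0 < T k - T i by rewrite subr_gt0.
pose A := g / (T i - T j) + g / (T k - T i).
have gj : 0 < g / (T i - T j) by rewrite divr_gt0.
have gk : 0 < g / (T k - T i) by rewrite divr_gt0.
have [||r] := @EVT_min R (inv_lik i) (- A) A; first by rewrite /A; lra.
  by apply: continuous_subspaceT; exact: continuous_inv_lik.
rewrite in_itv/= => rA rmin; exists r => s.
have r0 : inv_lik i r <= g by apply: rmin; rewrite in_itv/= /A; apply/andP; split; lra.
have [sA|sA] := leP `|s| A; first by apply: rmin; rewrite in_itv/= -ler_norml.
apply: (le_trans r0); move: sA; rewrite lter_normr => /orP[sA|sA].
  have : g / (T k - T i) < s by rewrite /A in sA; lra.
  by rewrite ltr_pdivrMr// => gs; have := inv_lik_ge_linear i k s; lra.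
have : g / (T i - T j) < - s by rewrite /A in sA; lra.
by rewrite ltr_pdivrMr// => gs; have := inv_lik_ge_linear i j s; lra.
Qed.

Lemma inv_lik_decr i k : (forall j, T j <= T i) -> T k < T i ->
  {homo inv_lik i : r s / r < s >-> s < r}.
Proof.
move=> imax ki r s rs; rewrite /inv_lik (bigD1 k)//= [ltRHS](bigD1 k)//=.
apply: ltr_leD; first by rewrite ltr_expR ltr_nM2r// subr_lt0.
by apply: ler_sum => j _; rewrite ler_expR ler_wnM2r ?subr_le0//; exact: ltW.
Qed.

Lemma inv_lik_incr i k : (forall j, T i <= T j) -> T i < T k ->
  {homo inv_lik i : r s / r < s}.
Proof.
move=> imin ik r s rs; rewrite /inv_lik (bigD1 k)//= [ltRHS](bigD1 k)//=.
apply: ltr_leD; first by rewrite ltr_expR ltr_pM2r// subr_gt0.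
by apply: ler_sum => j _; rewrite ler_expR ler_wpM2r ?subr_ge0//; exact: ltW.
Qed.

Let lik i r := (inv_lik i r)^-1.

Let lik_ub i : has_ubound (range (lik i)).
Proof.
by exists 1 => _ [r _ <-]; rewrite invf_le1 ?inv_lik_ge1// inv_lik_gt0.
Qed.

(** The estimate is finite when [T i] is neither extreme value of [T], infinite when it is exactly
    one of them, and arbitrary when [T] is constant. *)
Lemma extended_argmax_exists i : exists b, extended_argmax (lik i) b.
Proof.
have [[j ji]|noj] := pselect (exists j, T j < T i);
    have [[k ik]|nok] := pselect (exists k, T i < T k).
- have [r rmin] := inv_lik_argmin ji ik; exists r%:E => /= s.
  by rewrite /lik lef_pV2 ?posrE ?inv_lik_gt0.
- exists +oo%E.
  have imax k : T k <= T i by rewrite leNgt; apply/negP => ik; apply: nok; exists k.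
  have inc : {homo lik i : r s / r < s}.
    by move=> r s rs; rewrite /lik ltf_pV2 ?posrE ?inv_lik_gt0// (inv_lik_decr imax ji).
  split; first by move=> r; exists (r + 1); apply: inc; lra.
  by apply: nondecreasing_cvgr => //; exact: ltW_homo.
- exists -oo%E.
  have imin j : T i <= T j by rewrite leNgt; apply/negP => ji; apply: noj; exists j.
  have dec : {homo lik i : r s / r < s >-> s < r}.
    by move=> r s rs; rewrite /lik ltf_pV2 ?posrE ?inv_lik_gt0// (inv_lik_incr imin ik).
  split; first by move=> r; exists (r - 1); apply: dec; lra.
  have rangeN : range (lik i) = range (fun r => lik i (- r)).
    by apply/seteqP; split => _ [r _ <-]; exists (- r); rewrite ?opprK.
  apply/cvgNy_compNP; rewrite rangeN; apply: nondecreasing_cvgr; last by rewrite -rangeN.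
  by apply: ltW_homo => r s rs; apply: dec; rewrite ltrN2.
- exists 0%E => /= s; rewrite /lik lef_pV2 ?posrE ?inv_lik_gt0// /inv_lik ler_sum// => j _.
  have -> : T j = T i.
    by apply/eqP; rewrite eq_le !leNgt; apply/andP; split; apply/negP => ?;
      [apply: nok|apply: noj]; exists j.
  by rewrite subrr !mulr0.
Qed.

Let sup_lik_gt i : lik i 0 / 2 < sup (range (lik i)).
Proof.
have : lik i 0 <= sup (range (lik i)) by apply: ub_le_sup => //; exists 0.
have : 0 < lik i 0 by rewrite invr_gt0 inv_lik_gt0.
by lra.
Qed.

(** The term of [j] makes the likelihood tend to 0 at +oo, so it eventually drops below half its
    value at 0. *)
Lemma extended_argmax_neqy i j : T i < T j -> ~ extended_argmax (lik i) +oo%E.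
Proof.
move=> ij [_ cv]; have dj : 0 < T j - T i by rewrite subr_gt0.
near (+oo : set_system R) => r.
have rbig : 2 * inv_lik i 0 / (T j - T i) <= r by near: r; apply: nbhs_pinfty_ge; exact: num_real.
have : lik i 0 / 2 < lik i r by near: r; exact: (cvgr_gt _ cv _ (sup_lik_gt i)).
rewrite /lik -invfM ltf_pV2 ?posrE ?mulr_gt0 ?inv_lik_gt0//.
rewrite ler_pdivrMr// in rbig; have := inv_lik_ge_linear i j r; lra.
Unshelve. all: by end_near. Qed.

Lemma extended_argmax_neqNy i j : T j < T i -> ~ extended_argmax (lik i) -oo%E.
Proof.
move=> ij [_ cv]; have dj : 0 < T i - T j by rewrite subr_gt0.
near (-oo : set_system R) => r.
have rbig : r <= - (2 * inv_lik i 0 / (T i - T j)).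
  by near: r; apply: nbhs_ninfty_le; exact: num_real.
have : lik i 0 / 2 < lik i r by near: r; exact: (cvgr_gt _ cv _ (sup_lik_gt i)).
rewrite /lik -invfM ltf_pV2 ?posrE ?mulr_gt0 ?inv_lik_gt0//.
rewrite lerNr ler_pdivrMr// in rbig; have := inv_lik_ge_linear i j r; lra.
Unshelve. all: by end_near. Qed.

Lemma extended_argmax_lt i j (a b : \bar R) : T i < T j ->
  extended_argmax (lik i) a -> extended_argmax (lik j) b -> (a < b)%E.
Proof.
move=> ij; case: a => [r| |].
- case: b => [s| |] rmax smax; last 2 first.
  + by rewrite ltry.
  + by have := extended_argmax_neqNy ij smax.
  have rmin x : inv_lik i r <= inv_lik i x.
    by rewrite -[leLHS]invrK -[leRHS]invrK lef_pV2 ?posrE ?invr_gt0 ?inv_lik_gt0 ?rmax.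
  have smin x : inv_lik j s <= inv_lik j x.
    by rewrite -[leLHS]invrK -[leRHS]invrK lef_pV2 ?posrE ?invr_gt0 ?inv_lik_gt0 ?smax.
  (* If the estimates coincide, the two likelihood equations differ by the positive quantity
     [(T j - T i) * inv_lik i r]. If [s < r], then [r] beats [s] for the observation [j], because
     the two functions differ by a strictly decreasing exponential factor. *)
  rewrite lte_fin ltNge le_eqVlt; apply/negP => /orP[/eqP sr|sr].
    have stat_i := inv_lik_min_stationary rmin.
    have stat_j : \sum_k (T k - T j) * expR (r * (T k - T i)) = 0.
      have stat_s := inv_lik_min_stationary smin.
      transitivity (expR (s * (T j - T i)) * \sum_k (T k - T j) * expR (s * (T k - T j))).
        rewrite mulr_sumr; apply: eq_bigr => k _; rewrite mulrCA -expRD sr.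
        by congr (_ * expR _); ring.
      by rewrite stat_s mulr0.
    have : 0 < (T j - T i) * inv_lik i r by rewrite mulr_gt0 ?subr_gt0 ?inv_lik_gt0.
    suff -> : (T j - T i) * inv_lik i r = \sum_k (T k - T i) * expR (r * (T k - T i)) -
        \sum_k (T k - T j) * expR (r * (T k - T i)) by rewrite stat_i stat_j subr0 ltxx.
    by rewrite /inv_lik mulr_sumr -sumrB; apply: eq_bigr => k _; ring.
  have := smin r; rewrite !(inv_lik_shift i j) leNgt => /negP; apply.
  apply: (@lt_le_trans _ _ (expR (s * (T i - T j)) * inv_lik i r)); last first.
    by rewrite ler_wpM2l ?expR_ge0.
  by rewrite ltr_pM2r ?inv_lik_gt0// ltr_expR ltr_nM2r// subr_lt0.
- by move=> /(extended_argmax_neqy ij).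
- by case: b => [s _ _| _ _|_ /(extended_argmax_neqNy ij)//]; rewrite ?ltNyr ?ltNyy.
Qed.

End ExponentialFamily.

(** * The ML estimate orders configurations by the [p]-th power of the mean *)

Section MaximumLikelihood.
Variables (R : realType) (p : nat).

Lemma pmf_inv_lik n (X : config n) : (0 < n)%N ->
  (fun r : R => Defs.pmf p r X) =
  (fun r => (inv_lik (fun Y : config n => n%:R * mean R Y ^+ p) X r)^-1).
Proof.
move=> n0; apply/funext => r; rewrite pmfE -[LHS]invrK invf_div /inv_lik mulr_suml.
congr (_^-1); apply: eq_bigr => Y _; rewrite !weightE// -expRB; congr expR; ring.
Qed.

Lemma mle_extended_argmax n (X : config n) : (0 < n)%N ->
  extended_argmax
    (fun r => (inv_lik (fun Y : config n => n%:R * mean R Y ^+ p) X r)^-1)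
    (Defs.mle R p X).
Proof.
move=> n0; rewrite -pmf_inv_lik//; apply: (xgetPex 0%E (P := is_mle p X)).
rewrite -[is_mle p X]/(extended_argmax (fun r => Defs.pmf p r X)) pmf_inv_lik//.
exact: extended_argmax_exists.
Qed.

Lemma mle_lt n (X Y : config n) : (0 < n)%N ->
  (Defs.mle R p X < Defs.mle R p Y)%E = (mean R X ^+ p < mean R Y ^+ p).
Proof.
move=> n0; have n0R : 0 < n%:R :> R by rewrite ltr0n.
have lt (Z W : config n) : mean R Z ^+ p < mean R W ^+ p -> (Defs.mle R p Z < Defs.mle R p W)%E.
  move=> ZW; have ZW' : n%:R * mean R Z ^+ p < n%:R * mean R W ^+ p by rewrite ltr_pM2l.
  exact: (extended_argmax_lt (T := fun Y : config n => n%:R * mean R Y ^+ p) ZW'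
    (mle_extended_argmax Z n0) (mle_extended_argmax W n0)).
have [XY|YX|XY] := ltgtP (mean R X ^+ p); first exact: lt.
  by apply/negbTE; rewrite -leNgt ltW// lt.
(* Equal statistics give the same likelihood function, hence the same choice by [xget], whether or
   not the maximizer is unique. *)
suff -> : Defs.mle R p X = Defs.mle R p Y by rewrite ltxx.
congr xget; apply/funext => b.
rewrite -[is_mle p X b]/(extended_argmax (fun r => Defs.pmf p r X) b).
rewrite -[is_mle p Y b]/(extended_argmax (fun r => Defs.pmf p r Y) b).
congr extended_argmax; apply/funext => r.
by rewrite !pmfE !weightE// XY.
Qed.

End MaximumLikelihood.

(** * Exponential rates of events as n grows *)

Section Slope.
Variables (R : realType) (p : nat).
Implicit Types (b x y M : R).

Lemma exists_ups n k : (k <= n)%N -> exists X : config n, ups X = k.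
Proof.
move=> kn; have : (0 < #|[pred X : config n | ups X == k]|)%N by rewrite card_ups bin_gt0.
by move=> /card_gt0P[X]; rewrite inE => /eqP; exists X.
Qed.

Lemma mean_dense (u v y : R) : -1 <= u -> u < y -> y < v -> v <= 1 ->
  \forall n \near \oo, exists X : config n, u < mean R X < v.
Proof.
move=> u1 uy yv v1; pose d := Num.min (y - u) (v - y).
have d0 : 0 < d by rewrite lt_min !subr_gt0 uy yv.
near=> n.
have nd : 4 / d <= n%:R by near: n; exact: nbhs_infty_ger.
have nR : 0 < n%:R :> R by rewrite (lt_le_trans _ nd)// divr_gt0.
have n0 : (0 < n)%N by rewrite -(ltr0n R).
(* The number of +1 spins for which the mean would be [y]; rounding it down moves the mean by less
   than 2 / n. *)
pose z := n%:R * (1 + y) / 2.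
have z0 : 0 <= z by rewrite divr_ge0// mulr_ge0//; lra.
have /andP[kz zk] := truncn_itv z0; set k := Num.truncn z in kz zk.
have kn : (k <= n)%N by rewrite -(ler_nat R) (le_trans kz)// /z; nra.
have [X Xk] := exists_ups kn; exists X; rewrite mean_ups// Xk /level.
rewrite ler_pdivrMr// in nd; rewrite -natr1 in zk.
have du : d <= y - u by rewrite ge_min lexx.
have dv : d <= v - y by rewrite ge_min lexx orbT.
rewrite ltrBrDr ltrBlDr ltr_pdivlMr// ltr_pdivrMr//; rewrite /z in kz zk.
have : n%:R * d <= n%:R * (y - u) by rewrite ler_wpM2l// ltW.
have : 0 < n%:R * (v - y) by rewrite mulr_gt0// subr_gt0.
by move=> ? ?; apply/andP; split; nra.
Unshelve. all: by end_near. Qed.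

Lemma mean_dense_H b (u v y eta : R) : -1 <= u -> u < y -> y < v -> v <= 1 -> 0 < eta ->
  \forall n \near \oo, exists2 X : config n, u < mean R X < v & H b p y - eta <= H b p (mean R X).
Proof.
move=> u1 uy yv v1 eta0.
have /cvgrPdist_le /(_ _ eta0) /nbhs_ballP[d /= d0 dH] := @continuous_H R b p y.
have [u' u'1 u'2] : exists2 u', u <= u' < y & y - d < u'.
  exists (Num.max u (y - d / 2)); last by rewrite lt_max; apply/orP; right; lra.
  by rewrite le_max lexx/= gt_max uy/=; lra.
have [v' v'1 v'2] : exists2 v', y < v' <= v & v' < y + d.
  exists (Num.min v (y + d / 2)); last by rewrite gt_min; apply/orP; right; lra.
  by rewrite ge_min lexx/= lt_min yv/= andbT; lra.
move: u'1 v'1 => /andP[uu' u'y] /andP[yv' v'v].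
have := mean_dense (le_trans u1 uu') u'y yv' (le_trans v'v v1).
apply: filterS => n [X /andP[uX Xv]]; exists X.
  by rewrite (le_lt_trans uu')// (lt_le_trans Xv).
have := dH (mean R X); rewrite /ball/= => /(_ _).
rewrite ltr_distlC => /(_ _) Hd.
have : `|H b p y - H b p (mean R X)| <= eta by apply: Hd; apply/andP; split; lra.
by rewrite ler_distl => /andP[]; lra.
Qed.

(** The bound is uniform in the event [A], since a p-value is the probability of an event that
    depends on the observed configuration. *)
Lemma prob_le_exp b M (y eta : R) : -1 < y < 1 -> 0 < eta ->
  \forall n \near \oo, forall A : pred (config n),
    (forall X, A X -> H b p (mean R X) <= M) ->
    prob p b A <= expR (n%:R * (M - H b p y + eta)).
Proof.
move=> /andP[y1 y2] eta0; have eta2 : 0 < eta / 2 by rewrite divr_gt0.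
near=> n => A AM.
have n0 : (0 < n)%N by near: n; exact: nbhs_infty_gt.
have [X0 _ X0y] : exists2 X : config n, -1 < mean R X < 1 & H b p y - eta / 2 <= H b p (mean R X).
  near: n; exact: mean_dense_H.
have pol : n.+1%:R ^+ 2 <= expR (n%:R * (eta / 2)).
  by near: n; exact: polynomial_le_exp.
apply: (le_trans (probM_upper X0 n0 AM)).
apply: (le_trans (ler_wpM2r (expR_ge0 _) pol)).
by rewrite -expRD ler_expR -mulrDr ler_wpM2l//; lra.
Unshelve. all: by end_near. Qed.

Lemma exp_le_prob b M (u v y eta : R) :
  (forall x, -1 <= x <= 1 -> H b p x <= M) ->
  -1 <= u -> u < y -> y < v -> v <= 1 -> 0 < eta ->
  \forall n \near \oo, forall A : pred (config n),
    (forall X, u < mean R X < v -> A X) ->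
    expR (n%:R * (H b p y - M - eta)) <= prob p b A.
Proof.
move=> HM u1 uy yv v1 eta0; have eta2 : 0 < eta / 2 by rewrite divr_gt0.
near=> n => A AX.
have n0 : (0 < n)%N by near: n; exact: nbhs_infty_gt.
have [X0 X0uv X0y] : exists2 X : config n, u < mean R X < v & H b p y - eta / 2 <= H b p (mean R X).
  near: n; exact: mean_dense_H.
have pol : n.+1%:R ^+ 2 <= expR (n%:R * (eta / 2)).
  by near: n; exact: polynomial_le_exp.
have AX0 X : mean R X = mean R X0 -> A X by move=> XX0; apply: AX; rewrite XX0.
have := le_trans (probM_lower n0 HM AX0) (ler_wpM2r (prob_ge0 p b A) pol).
rewrite -ler_pdivrMl ?expR_gt0// -expRN -expRD; apply: le_trans.
by rewrite ler_expR -mulrN -mulrDr ler_wpM2l//; lra.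
Unshelve. all: by end_near. Qed.

Lemma p_valueE (est : statistic R) b0 n (X : config n) : (0 < n)%N ->
  p_value est p b0 X = prob p b0 (fun Y : config n => est n X < est n Y)%E.
Proof.
move=> n0; rewrite /p_value /test_stat_cdf probC /prob; apply: eq_bigl => Y /=.
rewrite -ltNge /test_stat lte_pmul2l//; last by rewrite lte_fin sqrtr_gt0 ltr0n.
by rewrite lteD2rE.
Qed.

Lemma prob_cvg0 b (M y : R) (A : forall n, pred (config n)) : -1 < y < 1 ->
  M < H b p y -> (forall n (X : config n), (0 < n)%N -> A n X -> H b p (mean R X) <= M) ->
  prob p b (A n) @[n --> \oo] --> (0 : R).
Proof.
move=> y1 My AM; pose g := (H b p y - M) / 2.
have g0 : 0 < g by rewrite divr_gt0// subr_gt0.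
have cv : expR (- g) ^+ n @[n --> \oo] --> (0 : R).
  by apply: cvg_expr; rewrite ger0_norm ?expR_ge0// expR_lt1; lra.
apply: squeeze_cvgr (@cvg_cst _ (0 : R) _ _ _) cv.
near=> n; rewrite prob_ge0/= -expRM_natl.
have n0 : (0 < n)%N by near: n; exact: nbhs_infty_gt.
have -> : - g = M - H b p y + g by rewrite /g; lra.
have := fun X => AM n X n0; move: (A n).
by near: n; exact: prob_le_exp.
Unshelve. all: by end_near. Qed.

End Slope.

(** * From deterministic bounds near the mode to the slope *)

Section BahadurSlope.
Variables (R : realType) (p : nat).
Hypothesis p_ge3 : (3 <= p)%N.
Implicit Types (b x y M : R).

Let p_gt0 : (0 < p)%N. Proof. exact: leq_trans p_ge3. Qed.

(* For even p the law is symmetric and the mean concentrates at both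
   -m_* and m_*; the first condition discards the negative sign for odd p. *)
Definition near_mode b e n (X : config n) : bool :=
  (mean R X ^+ p == `|mean R X| ^+ p) && (`| `|mean R X| - mstar b p| < e).

Lemma exprn_neq_norm_le0 x : x ^+ p != `|x| ^+ p -> x ^+ p <= 0.
Proof.
have [x0|x0] := leP 0 x; first by rewrite ger0_norm// eqxx.
rewrite ltr0_norm// -[in x ^+ p](opprK x) exprNn -signr_odd.
case: odd => /=; last by rewrite mul1r eqxx.
by move=> _; rewrite expr1 mulN1r oppr_le0 exprn_ge0// oppr_ge0 ltW.
Qed.

(** A wrong sign of the mean makes its [p]-th power, hence [H], nonpositive, while the maximum of
    [H] is positive; a wrong modulus is excluded by [mstar_gap]. *)
Lemma near_mode_cvg b e : betastar R p < b -> 0 < e ->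
  prob p b (fun X : config n => ~~ near_mode b e X) @[n --> \oo] --> (0 : R).
Proof.
move=> bb e0; have /andP[m0 m1] := mstar_itv p_ge3 bb.
have b0 : 0 <= b := le_trans (betastar_ge0 R p_ge3) (ltW bb).
have [M Mm HM] := mstar_gap p_ge3 bb e0.
apply: (@prob_cvg0 _ _ _ (Num.max 0 M) (mstar b p)).
- by apply/andP; split; lra.
- by rewrite gt_max H_mstar_gt0.
- move=> n X n0; have x1 := mean_itv R X n0; rewrite negb_and -leNgt le_max.
  move=> /orP[/exprn_neq_norm_le0 xp|ex]; apply/orP; [left|right]; last exact: HM.
  by rewrite /H subr_le0 (le_trans _ (entropyI_ge0 p_ge3 x1))// mulr_ge0_le0.
Qed.

(** Here [l] is the supremum of [H b0 p] over the region of larger estimates, up to [eta]: that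
    region contains an interval around a nearly optimal [y], and [H] is at most [l + eta] on it. The
    p-value then decays at the rate [H b0 p (mstar b0 p) - l]. *)
Lemma slope_from_bounds (est : statistic R) (b0 b l : R) :
  betastar R p < b0 -> betastar R p < b ->
  (forall eta : R, 0 < eta -> exists e u y v : R, [/\ 0 < e,
    [/\ -1 <= u, u < y, y < v & v <= 1], l - eta <= H b0 p y &
    forall n (X : config n), (0 < n)%N -> near_mode b e X ->
      (forall Y : config n, u < mean R Y < v -> (est n X < est n Y)%E) /\
      (forall Y : config n, (est n X < est n Y)%E -> H b0 p (mean R Y) <= l + eta)]) ->
  is_bahadur_slope est p b0 b (2 * (H b0 p (mstar b0 p) - l)).
Proof.
move=> bb0 bb bounds eps eps0; have /andP[m0 m1] := mstar_itv p_ge3 bb0.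
have eta0 : 0 < eps / 4 by rewrite divr_gt0.
have [e [u [y [v [e0 [u1 uy yv v1] Hy estX]]]]] := bounds _ eta0.
apply: squeeze_cvgr (@cvg_cst _ (0 : R) _ _ _) (near_mode_cvg bb e0).
near=> n; rewrite prob_ge0 andTb.
have up : forall A : pred (config n), (forall Y, A Y -> H b0 p (mean R Y) <= l + eps / 4) ->
    prob p b0 A <= expR (n%:R * (l + eps / 4 - H b0 p (mstar b0 p) + eps / 4)).
  by near: n; apply: prob_le_exp => //; apply/andP; split; lra.
have low : forall A : pred (config n), (forall Y, u < mean R Y < v -> A Y) ->
    expR (n%:R * (H b0 p y - H b0 p (mstar b0 p) - eps / 4)) <= prob p b0 A.
  near: n; apply: (exp_le_prob (u := u) (v := v)) => // x x1.
  exact: le_H_mstar.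
apply: le_prob => X; apply: contraTN => gX.
have n0 : (0 < n)%N by near: n; exact: nbhs_infty_gt.
have [lowX upX] := estX n X n0 gX.
pose A : pred (config n) := fun Y => (est n X < est n Y)%E.
have {}up := up A upX; have {}low := low A lowX.
have P0 : 0 < prob p b0 A := lt_le_trans (expR_gt0 _) low.
rewrite p_valueE// lne_EFin//.
rewrite -EFinM -EFinB abse_EFin lee_fin -ltNge.
have nR : 0 < n%:R :> R by rewrite ltr0n.
have up' : n%:R^-1 * ln (prob p b0 A) <= l + eps / 4 - H b0 p (mstar b0 p) + eps / 4.
  by rewrite ler_pdivrMl// -[leRHS]expRK ler_ln ?posrE ?expR_gt0.
have low' : H b0 p y - H b0 p (mstar b0 p) - eps / 4 <= n%:R^-1 * ln (prob p b0 A).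
  by rewrite ler_pdivlMl// -[leLHS]expRK ler_ln ?posrE ?expR_gt0.
by rewrite mulKf ?pnatr_eq0// ltr_norml; apply/andP; split; lra.
Unshelve. all: by end_near. Qed.

Lemma slope_unique (est : statistic R) b0 b c c' :
  is_bahadur_slope est p b0 b c -> is_bahadur_slope est p b0 b c' -> c = c'.
Proof.
move=> sc sc'; apply/eqP; rewrite -subr_eq0 -normr_eq0; apply: contraT => cc'.
(* The two limits are 4e apart, so no value lies within e of both. *)
pose e := `|c - c'| / 8.
have e0 : 0 < e by rewrite divr_gt0// lt_neqAle eq_sym cc' normr_ge0.
have h : (1/4 : R) > 0 by lra.
pose Y n (X : config n) : \bar R := ((n%:R^-1)%:E * lne (p_value est p b0 X)%:E)%E.
pose A a n : pred (config n) := fun X => (e%:E <= `|Y n X - (- (2^-1 * a))%:E|)%E.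
near \oo => n.
have Ac : prob p b (A c n) < 1 / 4 by near: n; exact: (cvgr_lt _ (sc _ e0) _ h).
have Ac' : prob p b (A c' n) < 1 / 4 by near: n; exact: (cvgr_lt _ (sc' _ e0) _ h).
have : prob p b (xpredT : pred (config n)) <= prob p b (A c n) + prob p b (A c' n).
  apply: prob_setU => X _; apply: contraT; rewrite /A negb_or -!ltNge.
  case: (Y n X) => [r| |] /andP[]//.
  rewrite -!EFinB !abse_EFin !lte_fin !ltr_norml /e.
  by case: (ler0P (c - c')) => ? /andP[? ?] /andP[? ?]; lra.
by rewrite prob_predT; lra.
Unshelve. all: by end_near. Qed.

Lemma bahadur_slope_eq (est : statistic R) b0 b c :
  is_bahadur_slope est p b0 b c -> bahadur_slope est p b0 b = c.
Proof.
by move=> sc; apply: (slope_unique (xgetPex 0 (ex_intro _ c sc)) sc).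
Qed.

End BahadurSlope.

(** * The slopes of the two estimators *)

Section Estimators.
Variables (R : realType) (p : nat).
Hypothesis p_ge3 : (3 <= p)%N.
Implicit Types (b x y M : R).

Let p_gt0 : (0 < p)%N. Proof. exact: leq_trans p_ge3. Qed.

Lemma continuous_H_le b y eta : 0 < eta ->
  exists2 d, 0 < d & forall z, `|y - z| < d ->
    H b p y - eta <= H b p z <= H b p y + eta.
Proof.
move=> eta0; have /cvgrPdist_le /(_ _ eta0) /nbhs_ballP[d /= d0 dH] := @continuous_H R b p y.
by exists d => // z yz; have := dH z yz; rewrite distrC ler_distl.
Qed.

Lemma mle_slope b0 b : betastar R p < b0 -> b0 < b ->
  is_bahadur_slope (Defs.mle R p) p b0 b
    (2 * (H b0 p (mstar b0 p) - H b0 p (mstar b p))).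
Proof.
move=> bb0 b0b; have bb := lt_trans bb0 b0b.
set m := mstar b p; set m0 := mstar b0 p.
have /andP[m00 m01] := mstar_itv p_ge3 bb0; rewrite -/m0 in m00 m01.
have /andP[mb0 mb1] := mstar_itv p_ge3 bb; rewrite -/m in mb0 mb1.
have mm : m0 < m by exact: mstar_lt.
apply: slope_from_bounds => // eta eta0.
have [d d0 dH] := continuous_H_le b0 m eta0.
pose e := Num.min d (Num.min (m - m0) (1 - m)) / 2.
have [e0 ed em e1] : [/\ 0 < e, 2 * e <= d, 2 * e <= m - m0 & 2 * e <= 1 - m].
  have -> : 2 * e = Num.min d (Num.min (m - m0) (1 - m)) by rewrite /e; field.
  by rewrite /e divr_gt0// ?lt_min ?d0 ?subr_gt0 ?mm// !ge_min !lexx ?orbT.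
(* A mean above m + e beats every observation near the mode. Conversely a larger estimate needs a
   modulus above m - e, where [H b0 p] already decreases. *)
exists e, (m + e), (m + 3 / 2 * e), 1; split => //.
- by split; lra.
- suff /dH /andP[] : `|m - (m + 3 / 2 * e)| < d by [].
  by rewrite distrC ger0_norm; lra.
move=> n X n0 /andP[/eqP Xp Xm]; move: Xm; rewrite ltr_distl -/m => /andP[Xm Xm'].
have X0 := normr_ge0 (mean R X).
split=> Y; rewrite mle_lt// Xp.
  by move=> /andP[uY Yv]; rewrite ltr_pXn2r// ?nnegrE; lra.
move=> XY; have {}XY : `|mean R X| < `|mean R Y|.
  have : `|mean R X| ^+ p < `|mean R Y| ^+ p.
    by rewrite (lt_le_trans XY)// -normrX ler_norm.
  by rewrite ltr_pXn2r// nnegrE.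
have Y1 : `|mean R Y| <= 1 by rewrite ler_norml mean_itv.
have b00 : 0 <= b0 := le_trans (betastar_ge0 R p_ge3) (ltW bb0).
apply: (le_trans (le_H_norm p _ b00)).
apply: (@le_trans _ _ (H b0 p (m - e))).
  by apply/ltW/H_decr_past_mstar => //; rewrite -/m0; lra.
suff /dH /andP[] : `|m - (m - e)| < d by [].
by rewrite ger0_norm; lra.
Qed.

Lemma stat_betaN x : stat_beta p (- x) = (-1) ^+ p * stat_beta p x.
Proof.
rewrite /stat_beta; have -> : artanhR (- x) = - artanhR x.
  by rewrite /artanhR opprK -mulrN opprB.
have [q ->] : exists q, p = q.+1 by case: (p) p_gt0 => // q; exists q.
have sq : ((-1) ^+ q)^-1 = (-1) ^+ q :> R by rewrite -exprVn invrN1.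
by rewrite /= [(- x) ^+ q]exprNn exprS mulrCA invfM sq; ring.
Qed.

Lemma artanh_fin x : -1 < x < 1 -> artanh x = (artanhR x)%:E.
Proof.
by move=> /andP[? ?]; rewrite /artanh !lne_EFin//; lra.
Qed.

Lemma mple_fin n (X : config n) : 0 < `|mean R X| < 1 ->
  mple R p X = (stat_beta p (mean R X))%:E.
Proof.
rewrite normr_gt0 ltr_norml /mple => /andP[x0 x1]; rewrite (negbTE x0) artanh_fin//.
rewrite -EFinM /stat_beta invfM; congr EFin.
have -> : 1 - p%:Z = - (p.-1)%:Z by case: (p) p_gt0 => // q _ /=; rewrite -addn1 PoszD; ring.
by rewrite -exprnN; ring.
Qed.

Lemma mple_near_mode b e n (X : config n) : betastar R p < b ->
  e < mstar b p -> e < 1 - mstar b p -> near_mode p b e X ->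
  mple R p X = (stat_beta p `|mean R X|)%:E.
Proof.
move=> bb em e1 /andP[/eqP Xp]; rewrite ltr_distl => /andP[Xm Xm'].
rewrite mple_fin; last by apply/andP; split; lra.
move: Xp; have [//|x0] := ger0P (mean R X).
rewrite exprNn => Xp; have Xn : mean R X ^+ p != 0 by rewrite expf_neq0// lt_eqF.
(* A negative mean near the mode forces [p] to be even, and then [stat_beta p] is even. *)
have sp : (-1) ^+ p = 1 :> R by apply: (mulIf Xn); rewrite mul1r.
by rewrite stat_betaN sp mul1r.
Qed.

Lemma stat_beta_le_norm x : `|x| < 1 -> stat_beta p x <= stat_beta p `|x|.
Proof.
have [//|x0 x1] := ger0P x.
have sx : 0 < stat_beta p (- x) by apply: stat_beta_gt0 => //; rewrite oppr_gt0 x0.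
rewrite -[in leLHS](opprK x) stat_betaN -signr_odd.
by case: odd; rewrite ?expr1 ?expr0 ?mul1r ?mulN1r//; lra.
Qed.

(** Means 0 and of modulus 1, where the estimate is not given by [stat_beta], are treated apart; the
    rest is [le_H_stat_beta_gt] at the modulus. *)
Lemma le_H_mple_gt b0 c s n (Y : config n) : (0 < n)%N -> betastar R p < b0 ->
  mstar b0 p < c < 1 -> stat_beta p c <= s -> (s%:E < mple R p Y)%E ->
  H b0 p (mean R Y) <= Num.max 0 (H b0 p c).
Proof.
move=> n0 bb0 /andP[mc c1] cs sY.
have b00 : 0 <= b0 := le_trans (betastar_ge0 R p_ge3) (ltW bb0).
have Y1 : `|mean R Y| <= 1 by rewrite ler_norml mean_itv.
apply: (le_trans (le_H_norm p _ b00)).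
have [Y0|Yn0] := eqVneq (mean R Y) 0; first by rewrite Y0 normr0 H_at0// le_max lexx.
have Y0 : 0 < `|mean R Y| by rewrite normr_gt0.
move: Y1; rewrite le_eqVlt => /predU1P[->|Y1].
  by rewrite le_max (ltW (H_decr_past_mstar p_ge3 bb0 (ltW mc) c1 (lexx 1))) orbT.
apply: le_H_stat_beta_gt => //; rewrite ?mc ?Y0// (le_lt_trans cs)//.
move: sY; rewrite mple_fin ?Y0// lte_fin => /lt_le_trans; apply.
exact: stat_beta_le_norm.
Qed.

Lemma mple_slope b0 b : betastar R p < b0 -> b0 < b ->
  is_bahadur_slope (mple R p) p b0 b
    (2 * (H b0 p (mstar b0 p) - Num.max 0 (H b0 p (mstar b p)))).
Proof.
move=> bb0 b0b; have bb := lt_trans bb0 b0b.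
set m := mstar b p.
have /andP[m00 _] := mstar_itv p_ge3 bb0.
have /andP[m_gt0 m_lt1] : 0 < m < 1 := mstar_itv p_ge3 bb.
have mm : mstar b0 p < m by exact: mstar_lt.
have [w /andP[_ wm] inc] := stat_beta_incr_mstar p_ge3 bb; rewrite -/m in wm.
apply: slope_from_bounds => // eta eta0.
have [d d0 dH] := continuous_H_le b0 m eta0.
pose e := Num.min (Num.min d (m - w)) (Num.min (m - mstar b0 p) (1 - m)) / 2.
have e2 : 2 * e = Num.min (Num.min d (m - w)) (Num.min (m - mstar b0 p) (1 - m)).
  by rewrite /e; field.
have e0 : 0 < e by rewrite /e divr_gt0// !lt_min d0 !subr_gt0 wm mm.
have [ed ew em e1] : [/\ 2 * e <= d, 2 * e <= m - w, 2 * e <= m - mstar b0 p &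
    2 * e <= 1 - m] by rewrite e2 !ge_min !lexx ?orbT.
clearbody e; clear e2.
have me_itv : mstar b0 p < m - e < 1 by apply/andP; split; lra.
have incE (x y : R) : w <= x -> x < y -> y < 1 -> stat_beta p x < stat_beta p y.
  move=> wx xy y1; apply: inc => //; rewrite in_itv/=.
    by rewrite wx (lt_trans xy).
  by rewrite y1 andbT (le_trans wx (ltW xy)).
have near_mpleE n (X : config n) : near_mode p b e X ->
    mple R p X = (stat_beta p `|mean R X|)%:E /\ m - e < `|mean R X| < m + e.
  move=> gX; split; last by move: gX => /andP[_]; rewrite ltr_distl.
  by apply: mple_near_mode gX => //; rewrite -/m; lra.
have dme : `|m - (m - e)| < d by rewrite ger0_norm; lra.
have /andP[_ Hme] := dH _ dme.
have estY n (X Y : config n) : (0 < n)%N -> near_mode p b e X ->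
    (mple R p X < mple R p Y)%E -> H b0 p (mean R Y) <= Num.max 0 (H b0 p m) + eta.
  move=> n0 /near_mpleE[-> /andP[Xm Xm']] XY.
  have sX : stat_beta p (m - e) <= stat_beta p `|mean R X| by apply/ltW/incE; lra.
  apply: (le_trans (le_H_mple_gt n0 bb0 me_itv sX XY)).
  by rewrite ge_max addr_ge0 ?le_max ?lexx ?(ltW eta0)//= (le_trans Hme)// lerD2r le_max lexx orbT.
(* When [H b0 p m >= 0], the part of the region just above m attains the rate, as for ML. Otherwise
   the part near 0 dominates. *)
have [Hm|Hm] := leP 0 (H b0 p m).
  exists e, (m + e), (m + 3 / 2 * e), 1; split => //.
  - by split; lra.
  - suff /dH /andP[] : `|m - (m + 3 / 2 * e)| < d by [].
    by rewrite distrC ger0_norm; lra.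
  move=> n X n0 gX; split => [Y|Y]; last by have := estY n X Y n0 gX; rewrite (max_idPr Hm).
  have [-> /andP[Xm Xm']] := near_mpleE n X gX; move=> /andP[uY Yv].
  rewrite mple_fin ?lte_fin; first by apply: incE; lra.
  by rewrite gtr0_norm; lra.
(* Means in (0, d') give estimates above those of all observations near the mode, and [y] is close
   enough to 0 for [H b0 p y >= - eta]. *)
have [d' /andP[d'0 d'1] d'H] := stat_beta_near0 (stat_beta p (m + e)) p_ge3.
have [d2 d20 d2H] := continuous_H_le b0 0 eta0.
pose y := Num.min d' d2 / 2.
have y2 : 2 * y = Num.min d' d2 by rewrite /y; field.
have y0 : 0 < y by rewrite /y divr_gt0// lt_min d'0.
have [yd' yd2] : 2 * y <= d' /\ 2 * y <= d2 by rewrite y2 !ge_min !lexx ?orbT.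
clearbody y; clear y2.
exists e, 0, y, d'; split => //.
- by split; lra.
- rewrite -(H_at0 b0 p_gt0); suff /d2H /andP[] : `|0 - y| < d2 by [].
  by rewrite distrC subr0 gtr0_norm; lra.
move=> n X n0 gX; split => [Y|Y]; last by have := estY n X Y n0 gX; rewrite (max_idPl (ltW Hm)).
have [-> /andP[Xm Xm']] := near_mpleE n X gX; move=> /andP[Y0 Yd].
rewrite mple_fin; last by rewrite gtr0_norm//; lra.
rewrite lte_fin (lt_trans _ (d'H _ _)) ?Y0//.
by apply: incE; lra.
Qed.

End Estimators.

Lemma gt0_cvgM_pinfty (R : realFieldType) (T : Type) (F : set_system T) (FF : Filter F)
    (f g : T -> R) (c : R) : 0 < c ->
  f @ F --> c -> g @ F --> +oo -> (fun x => f x * g x) @ F --> +oo.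
Proof.
move=> c0 fc /cvgryPge gy; apply/cvgryPge => A.
have c2 : c / 2 < c by lra.
apply: filterS2 (cvgr_gt _ fc _ c2) (gy (Num.max 0 (A / (c / 2)))) => x cf.
rewrite ge_max => /andP[g0]; rewrite ler_pdivrMr ?divr_gt0// => Ag.
by rewrite (le_trans Ag)// mulrC ler_wpM2r// ltW.
Qed.

(** * Efficiency, and limits at the threshold *)

Section Limits.
Variables (R : realType) (p : nat).
Hypothesis p_ge3 : (3 <= p)%N.
Implicit Types (b x y M : R).

Let p_gt0 : (0 < p)%N. Proof. exact: leq_trans p_ge3. Qed.

Lemma bahadur_slope_mle b0 b : betastar R p < b0 -> b0 < b ->
  bahadur_slope (Defs.mle R p) p b0 b = 2 * (H b0 p (mstar b0 p) - H b0 p (mstar b p)).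
Proof. by move=> bb0 b0b; apply: bahadur_slope_eq (mle_slope p_ge3 bb0 b0b). Qed.

Lemma bahadur_slope_mple b0 b : betastar R p < b0 -> b0 < b ->
  bahadur_slope (mple R p) p b0 b =
  2 * (H b0 p (mstar b0 p) - Num.max 0 (H b0 p (mstar b p))).
Proof. by move=> bb0 b0b; apply: bahadur_slope_eq (mple_slope p_ge3 bb0 b0b). Qed.

Lemma H_mstar_lt b0 b : betastar R p < b0 -> b0 < b ->
  H b0 p (mstar b p) < H b0 p (mstar b0 p).
Proof.
move=> bb0 b0b; have /andP[_ m1] := mstar_itv p_ge3 (lt_trans bb0 b0b).
by apply: H_decr_past_mstar => //; [exact: mstar_lt|exact: ltW].
Qed.

Lemma bahadur_slope_mple_gt0 b0 b : betastar R p < b0 -> b0 < b ->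
  0 < bahadur_slope (mple R p) p b0 b.
Proof.
move=> bb0 b0b; rewrite bahadur_slope_mple// mulr_gt0// subr_gt0 gt_max.
by rewrite H_mstar_gt0//= H_mstar_lt.
Qed.

(** After cancellation the inequality says h < max(0, h) for [h = H b0 p (mstar b p)], that is h <
    0. *)
Lemma eff_gt1 b0 b : betastar R p < b0 -> b0 < b ->
  (1 < eff (Defs.mle R p) (mple R p) p b0 b) =
  (b0 < entropyI (mstar b p) / mstar b p ^+ p).
Proof.
move=> bb0 b0b; have /andP[m0 _] := mstar_itv p_ge3 (lt_trans bb0 b0b).
rewrite /eff ltr_pdivlMr ?bahadur_slope_mple_gt0// mul1r.
rewrite bahadur_slope_mle// bahadur_slope_mple// ltr_pM2l// ltrD2l ltrN2.
by rewrite lt_max ltxx orbF ltr_pdivlMr ?exprn_gt0// -[RHS]subr_lt0.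
Qed.

(** Ensures that the interval of more efficient nulls lies below the alternative. *)
Lemma entropyI_div_lt b : betastar R p < b ->
  entropyI (mstar b p) / mstar b p ^+ p < b.
Proof.
move=> bb; have /andP[m0 _] := mstar_itv p_ge3 bb.
by rewrite ltr_pdivrMr ?exprn_gt0// -subr_gt0; exact: H_mstar_gt0.
Qed.

Lemma near_betastar b : betastar R p < b ->
  \forall b0 \near (betastar R p)^'+, betastar R p < b0 /\ b0 < b.
Proof.
move=> bb; near=> b0; split; first by near: b0; exact: nbhs_right_gt.
by near: b0; exact: nbhs_right_lt.
Unshelve. all: by end_near. Qed.

Lemma H_cvg_betastar x :
  H b0 p x @[b0 --> (betastar R p)^'+] --> H (betastar R p) p x.
Proof.
apply: cvg_at_right_filter; apply: cvgB; last exact: cvg_cst.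
by apply: cvgM; [exact: cvg_id|exact: cvg_cst].
Qed.

Lemma H_mstar_cvg0 : H b0 p (mstar b0 p) @[b0 --> (betastar R p)^'+] --> (0 : R).
Proof.
have lim : b0 - betastar R p @[b0 --> (betastar R p)^'+] --> (0 : R).
  rewrite -(subrr (betastar R p)); apply: cvg_at_right_filter.
  by apply: cvgB; [exact: cvg_id|exact: cvg_cst].
(* The maximum is positive and at most [b0 - betastar R p]. *)
apply: squeeze_cvgr (@cvg_cst _ (0 : R) _ _ _) lim.
near=> b0; have bb0 : betastar R p < b0 by near: b0; exact: nbhs_right_gt.
by rewrite ltW ?H_mstar_gt0//= H_mstar_le_sub.
Unshelve. all: by end_near. Qed.

Lemma bahadur_slope_mle_cvg b : betastar R p < b ->
  bahadur_slope (Defs.mle R p) p b0 b @[b0 --> (betastar R p)^'+] -->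
  - 2 * H (betastar R p) p (mstar b p).
Proof.
move=> bb; have -> : - 2 * H (betastar R p) p (mstar b p) =
    2 * (0 - H (betastar R p) p (mstar b p)) by ring.
have lim : 2 * (H b0 p (mstar b0 p) - H b0 p (mstar b p)) @[b0 --> (betastar R p)^'+] -->
    2 * (0 - H (betastar R p) p (mstar b p)).
  by apply: cvgM; [exact: cvg_cst|exact: (cvgB H_mstar_cvg0 (@H_cvg_betastar _))].
move: lim; apply: cvg_trans; apply: near_eq_cvg; apply: filterS (near_betastar bb) => b0 [bb0 b0b].
by rewrite bahadur_slope_mle.
Qed.

(** Near the threshold [H b0 p (mstar b p)] is negative by continuity, so the slope is twice the
    maximum of [H b0 p], which tends to 0. *)
Lemma bahadur_slope_mple_cvg0 b : betastar R p < b ->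
  bahadur_slope (mple R p) p b0 b @[b0 --> (betastar R p)^'+] --> (0 : R).
Proof.
move=> bb; have Hneg := H_betastar_mstar_lt0 p_ge3 bb.
have -> : (0 : R) = 2 * 0 by rewrite mulr0.
have lim : 2 * H b0 p (mstar b0 p) @[b0 --> (betastar R p)^'+] --> 2 * (0 : R).
  by apply: cvgM; [exact: cvg_cst|exact: H_mstar_cvg0].
move: lim; apply: cvg_trans; apply: near_eq_cvg; near=> b0.
have [bb0 b0b] : betastar R p < b0 /\ b0 < b by near: b0; exact: near_betastar.
have Hb0 : H b0 p (mstar b p) < 0.
  by near: b0; exact: (cvgr_lt _ (@H_cvg_betastar (mstar b p)) _ Hneg).
by rewrite bahadur_slope_mple// (max_idPl (ltW Hb0)) subr0.
Unshelve. all: by end_near. Qed.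

Lemma bahadur_slope_mple_inv_cvgy b : betastar R p < b ->
  (bahadur_slope (mple R p) p b0 b)^-1 @[b0 --> (betastar R p)^'+] --> +oo.
Proof.
move=> bb; apply/gtr0_cvgV0.
  apply: filterS (near_betastar bb) => b0 [bb0 b0b].
  by rewrite invr_gt0 bahadur_slope_mple_gt0.
have := bahadur_slope_mple_cvg0 bb; apply: cvg_trans; apply: near_eq_cvg.
by apply: nearW => b0 /=; rewrite invrK.
Qed.

End Limits.

Theorem theorem4 (R : realType) (p : nat) (beta : R)
    (hp : (3 <= p)%N) (hbeta : betastar R p < beta) :
  [/\ (* the slopes at every null parameter beta0 < beta are well defined *)
      (forall beta0 : R, betastar R p < beta0 < beta ->
        (exists! c : R, is_bahadur_slope (@mle R p) p beta0 beta c) /\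
        (exists! c : R, is_bahadur_slope (@mple R p) p beta0 beta c)),
      [set beta0 : R | betastar R p < beta0 < beta /\
                       1 < eff (@mle R p) (@mple R p) p beta0 beta]
      = [set beta0 : R | betastar R p < beta0 <
                         entropyI (mstar beta p) / mstar beta p ^+ p],
      (forall delta : R, 0 < delta < 1 ->
        [/\ opt_sample_size (@mple R p) p beta0 beta delta
              @[beta0 --> (betastar R p)^'+] --> +oo,
            opt_sample_size (@mle R p) p beta0 beta delta
              @[beta0 --> (betastar R p)^'+]
              --> ln delta / H (betastar R p) p (mstar beta p)
          & (* the limit is finite *)
            H (betastar R p) p (mstar beta p) != 0])
    & eff (@mle R p) (@mple R p) p beta0 beta
        @[beta0 --> (betastar R p)^'+] --> +oo].
Proof.
have Hneg := H_betastar_mstar_lt0 hp hbeta.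
(* This is the limit of the ML slope; its positivity makes the efficiency diverge as the MPL slope
   tends to 0. *)
have H2 : 0 < - 2 * H (betastar R p) p (mstar beta p) by lra.
split.
- move=> b0 /andP[bb0 b0b]; split.
    exists (2 * (H b0 p (mstar b0 p) - H b0 p (mstar beta p))).
    by split=> [|c]; [|apply: slope_unique]; exact: mle_slope.
  exists (2 * (H b0 p (mstar b0 p) - Num.max 0 (H b0 p (mstar beta p)))).
  by split=> [|c]; [|apply: slope_unique]; exact: mple_slope.
- apply/seteqP; split=> b0 /=.
    by move=> [/andP[bb0 b0b]]; rewrite eff_gt1// bb0.
  move=> /andP[bb0 b0I]; have b0b := lt_trans b0I (entropyI_div_lt hp hbeta).
  by rewrite eff_gt1// bb0.
- move=> delta delta01; have ld : 0 < - 2 * ln delta by have := ln_lt0 delta01; lra.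
  split; last by rewrite lt_eqF.
    apply: (@gt0_cvgM_pinfty _ _ _ _ (cst (- 2 * ln delta)) _ _ ld _
      (bahadur_slope_mple_inv_cvgy hp hbeta)); exact: cvg_cst.
  have -> : ln delta / H (betastar R p) p (mstar beta p) =
      - 2 * ln delta * (- 2 * H (betastar R p) p (mstar beta p))^-1.
    by field; rewrite lt_eqF.
  apply: cvgM; first exact: cvg_cst.
  by apply: cvgV; [rewrite gt_eqF|exact: bahadur_slope_mle_cvg].
- apply: (@gt0_cvgM_pinfty _ _ _ _ (fun b0 => bahadur_slope (@mle R p) p b0 beta) _ _ H2
    _ (bahadur_slope_mple_inv_cvgy hp hbeta)).
  exact: bahadur_slope_mle_cvg.
Qed.
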